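(* Let $B\wr\mathcal{H}(d)$ be a quantum wreath product as in the context, and suppose $B$ has an algebra automorphism $b\mapsto b^\#$; extend it factorwise to $B^{\otimes k}$. Let $A$ be the free associative $K$-algebra generated by $B^{\otimes d}$ and symbols $H_1,\dots,H_{d-1}$, and let $\#:A\to B\wr\mathcal{H}(d)$ be the algebra homomorphism with $b_1\otimes\cdots\otimes b_d\mapsto b_1^\#\otimes\cdots\otimes b_d^\#$ and $H_i\mapsto -H_i+S_i$. Then $\#$ induces an algebra homomorphism $B\wr\mathcal{H}(d)\to B\wr\mathcal{H}(d)$ if and only if (1) $\sigma(R)=R^\#$ and $\sigma(S)=S^\#$; (2) for all $b\in B\otimes B$: $\sigma(b^\#)=\sigma(b)^\#$ and $S\,b^\#-\sigma(b^\#)\,S=\rho(b^\#)+\rho(b)^\#$; (3) if $d\ge3$, for all $i,j$ with $|i-j|=1$: $S_iS_jS_i+\sigma_i(S_j)R_i=S_jS_iS_j+\sigma_j(S_i)R_j$. In this case $\#$ is an automorphism of $B\wr\mathcal{H}(d)$.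
   Context: Let $K$ be a commutative ring and $B$ a unital associative $K$-algebra, free over $K$; tensor products over $K$. Fix $d\ge2$, $S,R\in B\otimes B$ and $K$-linear maps $\sigma,\rho:B\otimes B\to B\otimes B$. For $Z\in B\otimes B$, $Z_i:=1^{\otimes(i-1)}\otimes Z\otimes1^{\otimes(d-i-1)}\in B^{\otimes d}$; for $\phi\in\mathrm{End}_K(B\otimes B)$, $\phi_i$ is $\phi$ applied to tensor factors $i,i+1$ of $B^{\otimes d}$. The quantum wreath product $B\wr\mathcal{H}(d)$ is the unital $K$-algebra generated by the algebra $B^{\otimes d}$ and $H_1,\dots,H_{d-1}$ subject to $H_kH_{k+1}H_k=H_{k+1}H_kH_{k+1}$, $H_iH_j=H_jH_i$ ($|i-j|\ge2$), $H_i^2=S_iH_i+R_i$, $H_ib=\sigma_i(b)H_i+\rho_i(b)$ ($b\in B^{\otimes d}$). With $H_w$ defined via reduced expressions of $w\in\Sigma_d$, it is assumed that $B\wr\mathcal{H}(d)$ has a PBW basis $\{(b_{j_1}\otimes\cdots\otimes b_{j_d})H_w\}$ for a $K$-basis $\{b_j\}$ of $B$. *)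

(* Defs.v *)
(* Tensor powers of the free K-algebra B are modelled
   concretely as free K-modules on tuples of basis indices (multinomials'
   {malg K[n.-tuple I]} = finitely supported functions n.-tuple I -> K). *)
From HB Require Import structures.
From mathcomp Require Import all_boot all_order all_algebra all_fingroup.
From mathcomp Require Import finmap.
From mathcomp Require Import monalg.
Set Implicit Arguments. Unset Strict Implicit. Unset Printing Implicit Defensive.
Import GRing.Theory.
Local Open Scope ring_scope.

Section Tensor.
Variables (K : comNzRingType) (B : algType K) (I : choiceType).
Variables (e : I -> B) (co : B -> {malg K[I]}).

Definition is_basisB :=
  (forall b : B, \sum_(i <- msupp (co b)) (co b)@_i *: e i = b) /\
  (forall x : {malg K[I]}, co (\sum_(i <- msupp x) x@_i *: e i) = x).

(* B^{(x) n}: free K-module with basis e_{u_1} (x) ... (x) e_{u_n} *)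
Definition T (n : nat) := {malg K[n.-tuple I]}.

Definition bT (n : nat) (t : n.-tuple I) : T n := << t >>.

Definition allchoices (ss : seq (seq I)) : seq (seq I) :=
  foldr (fun s acc => [seq i :: u | i <- s, u <- acc]) [:: [::]] ss.

(* the pure tensor b_1 (x) ... (x) b_n *)
Definition ten (n : nat) (b : n.-tuple B) : T n :=
  \sum_(u <- allchoices [seq (msupp (co x) : seq I) | x <- b])
     (\prod_(p <- zip b u) (co p.1)@_p.2) *:
       (oapp (@bT n) (0 : T n) (insub u)).

Definition mulT (n : nat) (x y : T n) : T n :=
  \sum_(u <- msupp x) \sum_(v <- msupp y)
     (x@_u * y@_v) *: ten [tuple e (tnth u k) * e (tnth v k) | k < n].

Definition oneT (n : nat) : T n := ten [tuple (1 : B) | k < n].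

Definition mapT (f : B -> B) (n : nat) (x : T n) : T n :=
  \sum_(u <- msupp x) x@_u *: ten [tuple f (e (tnth u k)) | k < n].

(* Z_i = 1^{(x)(i-1)} (x) Z (x) 1^{(x)(d-i-1)}, for Z in B (x) B, 1 <= i <= d-1 *)
Definition placeT (d i : nat) (Z : T 2) : T d :=
  \sum_(u <- msupp Z) Z@_u *:
     ten [tuple (if k == i.-1 :> nat then e (tnth u ord0)
                 else if k == i :> nat then e (tnth u ord_max) else 1) | k < d].

(* phi_i : phi applied to tensor factors i, i+1 of B^{(x) d} *)
Definition liftT (d i : nat) (phi : T 2 -> T 2) (x : T d) : T d :=
  \sum_(u <- msupp x) x@_u *:
    (match drop i.-1 (val u) with
     | a :: b :: _ =>
        let y := phi (bT [tuple a; b]) in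
        \sum_(v <- msupp y) y@_v *:
          bT [tuple (if k == i.-1 :> nat then tnth v ord0
                     else if k == i :> nat then tnth v ord_max
                     else tnth u k) | k < d]
     | _ => 0
     end).

Definition algHomT (d : nat) (A : algType K) (f : T d -> A) :=
  (forall (a : K) (x y : T d), f (a *: x + y) = a *: f x + f y) /\
  (forall x y : T d, f (mulT x y) = f x * f y) /\ f (oneT d) = 1.

Definition wreath_rel (d : nat) (S R : T 2) (sigma rho : T 2 -> T 2)
    (A : algType K) (f : T d -> A) (h : nat -> A) :=
  (forall k, (1 <= k)%N -> (k.+1 < d)%N -> h k * h k.+1 * h k = h k.+1 * h k * h k.+1) /\
  (forall i j, (1 <= i < d)%N -> (1 <= j < d)%N -> (i.+2 <= j \/ j.+2 <= i)%N ->
      h i * h j = h j * h i) /\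
  (forall i, (1 <= i < d)%N -> h i * h i = f (placeT d i S) * h i + f (placeT d i R)) /\
  (forall i (x : T d), (1 <= i < d)%N ->
      h i * f x = f (liftT i sigma x) * h i + f (liftT i rho x)).

End Tensor.

Definition algHom (K : comNzRingType) (A A' : algType K) (g : A -> A') :=
  (forall (a : K) (x y : A), g (a *: x + y) = a *: g x + g y) /\
  (forall x y, g (x * y) = g x * g y) /\ g 1 = 1.

(* simple transposition s_i = (i, i+1) (1-indexed) in 'S_d *)
Definition sperm (d : nat) (i : nat) : 'S_d :=
  match @insub _ (fun k => k < d)%N _ i.-1, @insub _ (fun k => k < d)%N _ i with
  | Some a, Some b => tperm a b
  | _, _ => 1%g
  end.

Definition wperm (d : nat) (w : seq nat) : 'S_d := (\prod_(i <- w) sperm d i)%g.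

Definition valid_word (d : nat) (w : seq nat) := all (fun i => 1 <= i < d)%N w.

Definition reduced_expr (d : nat) (w : seq nat) (p : 'S_d) :=
  valid_word d w /\ wperm d w = p /\
  forall w', valid_word d w' -> wperm d w' = p -> (size w <= size w')%N.

Definition is_basis (K : comNzRingType) (M : lmodType K) (J : choiceType) (F : J -> M) :=
  forall m : M, exists! c : {malg K[J]}, m = \sum_(j <- msupp c) c@_j *: F j.

(* W, with iota : B^{(x)d} -> W and H_1..H_{d-1}, is the quantum wreath product
   B wr H(d): the algebra presented by the generators B^{(x)d}, H_i and the
   defining relations (universal property), and it has the PBW basis
   { (b_{u_1} (x) ... (x) b_{u_d}) H_w }. *)
Definition is_qwreath (K : comNzRingType) (B : algType K) (I : choiceType)
    (e : I -> B) (co : B -> {malg K[I]}) (d : nat) (S R : T K I 2)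
    (sigma rho : T K I 2 -> T K I 2)
    (W : algType K) (iota : T K I d -> W) (H : nat -> W) :=
  algHomT e co iota /\
  wreath_rel e co S R sigma rho iota H /\
  (forall (A : algType K) (f : T K I d -> A) (h : nat -> A),
      algHomT e co f -> wreath_rel e co S R sigma rho f h ->
      (exists g : W -> A, algHom g /\ (forall x, g (iota x) = f x) /\
                  (forall i, (1 <= i < d)%N -> g (H i) = h i)) /\
      (forall g1 g2 : W -> A, algHom g1 -> algHom g2 ->
         (forall x, g1 (iota x) = f x) -> (forall x, g2 (iota x) = f x) ->
         (forall i, (1 <= i < d)%N -> g1 (H i) = h i) ->
         (forall i, (1 <= i < d)%N -> g2 (H i) = h i) -> g1 =1 g2)) /\
  (exists rw : 'S_d -> seq nat,
      (forall p, reduced_expr (rw p) p) /\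
      is_basis (fun up : (d.-tuple I * 'S_d)%type =>
                  iota (bT K up.1) * \prod_(i <- rw up.2) H i)).

Definition algAut (K : comNzRingType) (B : algType K) (f : B -> B) :=
  algHom f /\ bijective f.

(* Main.v *)
(* [#] is prescribed on generators, so it induces an endomorphism exactly when the images
   satisfy the defining relations; each image relation is compared in the PBW basis.
   The wreath relation gives (2) and [sigma(S) = S^#]; together with the
   coefficient identity [sigma(S) S + rho(S) + sigma(R) = S^2 + R] coming from
   [H (H H) = (H H) H], the quadratic relation then gives [sigma(R) = R^#].  For the braid
   relation, the PBW basis in rank 3 forces [sigma_i sigma_j(S_i) = S_j],
   [rho_i sigma_j(S_i) = 0] and [S_i S_j = sigma_i(S_j) S_i + rho_i(S_j)]; with these, all
   coefficients of the two sides agree except the constant ones, whose equality is (3).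
   The inverse is [x |-> x^(#^-1)], [H_i |-> - H_i + S_i^(#^-1)], obtained in the same way. *)
Require Import Defs.
From HB Require Import structures.
From mathcomp Require Import all_boot all_order all_algebra all_fingroup.
From mathcomp Require Import finmap.
From mathcomp Require Import monalg.
From mathcomp Require Import zify.
Set Implicit Arguments. Unset Strict Implicit. Unset Printing Implicit Defensive.
Import GRing.Theory.
Local Open Scope ring_scope.

(** * Linear extension and pure tensors *)

Section LinearExtension.
Variables (K : comNzRingType) (J : choiceType) (M : lmodType K).
Implicit Types (f : J -> M) (x : {malg K[J]}).

(** The PBW basis comes with an unspecified choice of reduced words, but every comparison takes
    place among products of one generator or of two adjacent ones. Independence is therefore
    extracted only for the two, respectively six, permutations involved, whose reduced words can be
    determined by hand. The computations then run over an abstract ring [V] mapped to [W], where the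
    identities between [S], [sigma] and [rho] are read off from associativity and the braid
    relation. Conditions (1) and (2) live in [B (x) B]: they pass up to [B^{(x) d}] by checking pure
    tensors, and come back down because placing a tensor in two adjacent slots is injective. Distant
    generators impose no condition, since independence forces [sigma(1) = 1] and [rho(1) = 0]. The
    inverse shifts [H_i] by [S_i^(#^-1)] instead of [S_i], so products of shifted generators are
    expanded for arbitrary shifts; the identities needed for it arise by applying [#^-1] to those
    already found. *)

Definition lext f x : M := \sum_(u <- msupp x) x@_u *: f u.

Lemma lextEw f x (D : {fset J}) :
  (msupp x `<=` D)%fset -> lext f x = \sum_(u <- D) x@_u *: f u.
Proof.
move=> le; rewrite /lext (big_fset_incl _ le) // => u _ nu.
by rewrite mcoeff_outdom // scale0r.
Qed.

Lemma lext_linear f : linear (lext f).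
Proof.
move=> a x y; pose D := (msupp (a *: x + y) `|` msupp x `|` msupp y)%fset.
have le0 : (msupp (a *: x + y) `<=` D)%fset.
  by rewrite /D -fsetUA fsubsetUl.
have le1 : (msupp x `<=` D)%fset.
  by rewrite /D (fsetUC (msupp (_ + _))) -fsetUA fsubsetUl.
have le2 : (msupp y `<=` D)%fset by rewrite /D fsubsetUr.
rewrite (lextEw f le0) (lextEw f le1) (lextEw f le2) scaler_sumr -big_split /=.
by apply: eq_bigr => u _; rewrite mcoeffD mcoeffZ scalerDl scalerA.
Qed.

Lemma lextU f u : lext f << 1 *g u >> = f u.
Proof.
by rewrite /lext msuppU oner_eq0 big_seq_fset1 mcoeffUU scale1r.
Qed.

Lemma eq_lext f g x : f =1 g -> lext f x = lext g x.
Proof. by move=> fg; apply: eq_bigr => u _; rewrite fg. Qed.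

Lemma lext_fun_linear (a : K) f g x :
  lext (fun u => a *: f u + g u) x = a *: lext f x + lext g x.
Proof.
rewrite /lext scaler_sumr -big_split /=; apply: eq_bigr => u _.
by rewrite scalerDr !scalerA [a * _]mulrC.
Qed.

Lemma linear_on_sum (V : lmodType K) (h : V -> M) (A : Type) (r : seq A)
    (c : A -> K) (F : A -> V) :
  linear h -> h (\sum_(i <- r) c i *: F i) = \sum_(i <- r) c i *: h (F i).
Proof.
move=> lh; have h0 : h 0 = 0.
  by have := lh (-1) 0 0; rewrite scaler0 addr0 scaleN1r addNr.
by elim: r => [|i r IH]; rewrite ?big_nil // !big_cons lh IH.
Qed.

Lemma malg_sumU x : x = \sum_(u <- msupp x) x@_u *: << 1 *g u >>.
Proof.
rewrite {1}[x]monalgE; apply: eq_bigr => u _; apply/malgP => v.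
by rewrite mcoeffZ !mcoeffU mulrnAr mulr1.
Qed.

Lemma linear_malg_eq (f g : {malg K[J]} -> M) : linear f -> linear g ->
  (forall u, f << 1 *g u >> = g << 1 *g u >>) -> f =1 g.
Proof.
move=> lf lg fg x; rewrite [x]malg_sumU !linear_on_sum //.
by apply: eq_bigr => u _; rewrite fg.
Qed.

End LinearExtension.

Lemma linear_comp (K : comNzRingType) (U V M : lmodType K) (g : V -> M) (f : U -> V) :
  linear g -> linear f -> linear (fun x => g (f x)).
Proof. by move=> lg lf a x y; rewrite lf lg. Qed.

(** * Multilinear maps are determined by families of basis vectors *)

Section Multilinear.
Variables (K : comNzRingType) (B : algType K) (n : nat).

Definition upd (b : 'I_n -> B) (k : 'I_n) (x : B) : 'I_n -> B :=
  fun l => if l == k then x else b l.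

Definition multilinear (M : lmodType K) (F : ('I_n -> B) -> M) :=
  (forall b c, b =1 c -> F b = F c) /\
  (forall k b, linear (fun x => F (upd b k x))).

Lemma multilinear_comp (M N : lmodType K) (f : M -> N) (F : ('I_n -> B) -> M) :
  linear f -> multilinear F -> multilinear (fun b => f (F b)).
Proof.
move=> lf [eF lF]; split=> [b c bc|k b]; first by rewrite (eF _ _ bc).
exact: linear_comp lf (lF k b).
Qed.

Lemma multilinear_eq (M : lmodType K) (I : choiceType) (e : I -> B)
    (co : B -> {malg K[I]}) (F G : ('I_n -> B) -> M) :
  (forall b, \sum_(i <- msupp (co b)) (co b)@_i *: e i = b) ->
  multilinear F -> multilinear G ->
  (forall u : 'I_n -> I, F (fun k => e (u k)) = G (fun k => e (u k))) ->
  forall b, F b = G b.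
Proof.
move=> eb [eF lF] [eG lG] FG.
(* Only the first [m] factors may be arbitrary, the others are basis vectors; each induction step
   expands one more factor in the basis. *)
suff FGm m (b : 'I_n -> B) :
    (forall k : 'I_n, (m <= k)%N -> exists i, b k = e i) -> F b = G b.
  by move=> b; apply: (FGm n) => k; rewrite leqNgt ltn_ord.
elim: m b => [|m IH] b hb.
  have /fin_all_exists [u hu] k : exists i, b k = e i by apply: hb.
  by rewrite (eF _ _ hu) (eG _ _ hu).
have [ltmn|] := ltnP m n; last first.
  by move=> lenm; apply: IH => k lemk; have := ltn_ord k; lia.
pose k := Ordinal ltmn; pose b' x := upd b k x.
have bE : b =1 b' (b k) by move=> l; rewrite /b' /upd; case: eqP => // ->.
rewrite (eF _ _ bE) (eG _ _ bE) -[b k]eb !(linear_on_sum _ _ _ (lF k b), linear_on_sum _ _ _ (lG k b)).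
apply: eq_bigr => i _; congr (_ *: _); apply: IH => l leml; rewrite /b' /upd.
case: eqP => [_|/eqP nlk]; first by exists i.
by apply: hb; rewrite ltn_neqAle leml andbT; apply: contra nlk => /eqP ml; apply/eqP/val_inj.
Qed.

End Multilinear.

(** Indexing by functions lets a single factor vary through [upd]. The lock keeps conversion from
    unfolding the sum over index choices inside [ten]. *)
HB.lock Definition tenf (K : comNzRingType) (B : algType K) (I : choiceType)
    (co : B -> {malg K[I]}) n (b : 'I_n -> B) : T K I n :=
  ten co [tuple b k | k < n].

Section Tensors.
Variables (K : comNzRingType) (B : algType K) (I : choiceType).
Variables (e : I -> B) (co : B -> {malg K[I]}).
Hypothesis hbasis : is_basisB e co.

Let ek b : \sum_(i <- msupp (co b)) (co b)@_i *: e i = b.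
Proof. exact: hbasis.1. Qed.

Lemma co_e i : co (e i) = << 1 *g i >>.
Proof.
rewrite -[RHS](hbasis.2) msuppU oner_eq0 big_seq_fset1 mcoeffUU scale1r //.
Qed.

Lemma co_linear : linear co.
Proof.
move=> a x y; rewrite -[RHS](hbasis.2); congr co.
by rewrite -/(lext e _) lext_linear /lext !ek.
Qed.

(** The enumeration meets [v] at most once; if it misses [v], some coefficient on the right lies
    outside its support and the product is zero. *)
Lemma sum_allchoices_coef (s : seq B) (v : seq I) : size v = size s ->
  \sum_(u <- allchoices [seq (msupp (co x) : seq I) | x <- s])
     (\prod_(p <- zip s u) (co p.1)@_p.2) * (u == v)%:R =
  \prod_(p <- zip s v) (co p.1)@_p.2.
Proof.
elim: s v => [|x s IH] [|i v] //= => [_|[sv]].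
  by rewrite big_seq1 big_nil mul1r.
rewrite big_allpairs_dep big_cons -(IH v sv) /=.
transitivity (\sum_(j <- msupp (co x)) (co x)@_j * (j == i)%:R *
   \sum_(u <- allchoices [seq (msupp (co x) : seq I) | x <- s])
     (\prod_(p <- zip s u) (co p.1)@_p.2) * (u == v)%:R).
  apply: eq_bigr => j _; rewrite mulr_sumr; apply: eq_bigr => u _.
  rewrite big_cons eqseq_cons /=; case: (j == i); case: (u == v);
  by rewrite ?mulr1 ?mulr0 ?mul0r.
rewrite -mulr_suml; congr (_ * _).
have [iD|iD] := boolP (i \in msupp (co x)).
  rewrite (bigD1_seq i) //= eqxx mulr1 big1 ?addr0 // => j /negPf ->.
  by rewrite mulr0.
rewrite big_seq big1 ?mcoeff_outdom // => j jD.
by case: eqP => [ji|]; rewrite ?mulr0 //; rewrite ji (negPf iD) in jD.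
Qed.

Local Notation tenf := (tenf co).

(** With coordinates known, multilinearity becomes a statement about products in [K], and the
    enumeration of index choices can be forgotten. *)
Lemma mcoeff_tenf n (b : 'I_n -> B) (v : n.-tuple I) :
  (tenf b)@_v = \prod_(k < n) (co (b k))@_(tnth v k).
Proof.
rewrite tenf.unlock /ten raddf_sum /=.
transitivity (\sum_(u <- allchoices [seq (msupp (co x) : seq I) | x <- [tuple b k | k < n]])
   (\prod_(p <- zip [tuple b k | k < n] u) (co p.1)@_p.2) * (u == v)%:R).
  apply: eq_bigr => u _; rewrite mcoeffZ; congr (_ * _).
  case: insubP => [t _ tu|nu] /=; first by rewrite mcoeffU -tu val_eqE; case: eqP.
  rewrite mcoeff0; case: eqP => // uv; by rewrite uv size_tuple eqxx in nu.
rewrite sum_allchoices_coef ?size_tuple //.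
rewrite -{1}(map_tnth_enum v) /= zip_map big_map big_enum /=.
by [].
Qed.

Lemma T_ext n (x y : T K I n) : (forall v : n.-tuple I, x@_v = y@_v) -> x = y.
Proof. by move=> xy; apply/malgP. Qed.

Lemma mcoeffT n (a : K) (x y : T K I n) (v : n.-tuple I) :
  (a *: x + y)@_v = a * x@_v + y@_v.
Proof. by rewrite mcoeffD mcoeffZ. Qed.

Lemma ten_tenf n (b : 'I_n -> B) : ten co [tuple b k | k < n] = tenf b.
Proof. by rewrite tenf.unlock. Qed.

Lemma tenf_multilinear n : multilinear (tenf (n := n)).
Proof.
split=> [b c bc|k b a x y]; apply: T_ext => v.
  by rewrite (mcoeff_tenf b v) (mcoeff_tenf c v); apply: eq_bigr => k _; rewrite bc.
have updE z : (tenf (upd b k z))@_v =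
    (co z)@_(tnth v k) * \prod_(l < n | l != k) (co (b l))@_(tnth v l).
  rewrite (mcoeff_tenf _ v) (bigD1 k) //= /upd eqxx; congr (_ * _).
  by apply: eq_bigr => l /negPf ->.
by rewrite mcoeffT !updE co_linear mcoeffD mcoeffZ mulrDl mulrA.
Qed.

Lemma eq_tenf n (b c : 'I_n -> B) : b =1 c -> tenf b = tenf c.
Proof. exact: (tenf_multilinear n).1. Qed.

Lemma tenf_e n (u : 'I_n -> I) : tenf (fun k => e (u k)) = bT K [tuple u k | k < n].
Proof.
apply/malgP => v; rewrite mcoeff_tenf mcoeffU.
under eq_bigr do rewrite co_e mcoeffU.
have [<-|uv] := eqVneq [tuple u k | k < n] v.
  by rewrite big1 // => k _; rewrite tnth_mktuple eqxx.
have /existsP[k uvk] : [exists k, u k != tnth v k].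
  rewrite -negb_forall; apply: contra uv => /forallP h; apply/eqP/eq_from_tnth => k.
  by rewrite tnth_mktuple; apply/eqP.
by rewrite (bigD1 k) //= (negPf uvk) mul0r.
Qed.

Lemma bT_tenf n (u : n.-tuple I) : bT K u = tenf (fun k => e (tnth u k)).
Proof. by rewrite tenf_e; congr bT; apply/eq_from_tnth => k; rewrite tnth_mktuple. Qed.

Lemma tenf_eq n (M : lmodType K) (F G : ('I_n -> B) -> M) :
  multilinear F -> multilinear G ->
  (forall u : 'I_n -> I, F (fun k => e (u k)) = G (fun k => e (u k))) ->
  forall b, F b = G b.
Proof. exact: (multilinear_eq ek). Qed.

Lemma linear_T_eq n (M : lmodType K) (f g : T K I n -> M) : linear f -> linear g ->
  (forall b, f (tenf b) = g (tenf b)) -> f =1 g.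
Proof.
by move=> lf lg fg; apply: linear_malg_eq => // u; rewrite -[mkmalgU _ _]/(bT K u) bT_tenf fg.
Qed.

Lemma mapT_lext f n (x : T K I n) :
  mapT e co f x = lext (fun u : n.-tuple I => tenf (fun k => f (e (tnth u k)))) x.
Proof. by apply: eq_bigr => u _; rewrite ten_tenf. Qed.

Lemma mapT_linear f n : linear (@mapT K B I e co f n).
Proof. exact: lext_linear. Qed.

Lemma mapT_tenf f n (b : 'I_n -> B) : linear f ->
  mapT e co f (tenf b) = tenf (fun k => f (b k)).
Proof.
move=> lf; move: b; apply: tenf_eq.
- exact: multilinear_comp (@mapT_linear f n) (tenf_multilinear n).
- split=> [b c bc|k b a x y]; first by apply: eq_tenf => k; rewrite bc.
  have fupd z : (fun l => f (upd b k z l)) =1 upd (fun l => f (b l)) k (f z).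
    by move=> l; rewrite /upd; case: eqP.
  by rewrite !(eq_tenf (fupd _)) lf (tenf_multilinear n).2.
- move=> u; rewrite tenf_e mapT_lext lextU.
  by apply: eq_tenf => k; rewrite tnth_mktuple.
Qed.

Lemma mulT_lext n (x y : T K I n) : mulT e co x y =
  lext (fun u : n.-tuple I => lext (fun v : n.-tuple I =>
    tenf (fun k => e (tnth u k) * e (tnth v k))) y) x.
Proof.
apply: eq_bigr => u _; rewrite /lext scaler_sumr; apply: eq_bigr => v _.
by rewrite scalerA ten_tenf.
Qed.

Lemma mulT_linearl n (y : T K I n) : linear (fun x => mulT e co x y).
Proof. by move=> a x x'; rewrite !mulT_lext lext_linear. Qed.

Lemma mulT_linearr n (x : T K I n) : linear (mulT e co x).
Proof.
move=> a y y'; rewrite !mulT_lext -lext_fun_linear; apply: eq_lext => u.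
exact: lext_linear.
Qed.

Lemma mulT_tenf n (b c : 'I_n -> B) :
  mulT e co (tenf b) (tenf c) = tenf (fun k => b k * c k).
Proof.
have mul_updl (b' : 'I_n -> B) (g : 'I_n -> B -> B) k :
    (forall l, linear (g l)) ->
    linear (fun x => tenf (fun l => g l (upd b' k x l))).
  move=> lg a x y.
  have gupd z : (fun l => g l (upd b' k z l)) =1 upd (fun l => g l (b' l)) k (g k z).
    by move=> l; rewrite /upd; case: eqP => [->|].
  by rewrite !(eq_tenf (gupd _)) lg (tenf_multilinear n).2.
move: b; apply: tenf_eq.
- exact: multilinear_comp (@mulT_linearl n _) (tenf_multilinear n).
- split=> [b b' bb|k b]; first by apply: eq_tenf => k; rewrite bb.
  apply: (mul_updl b (fun l z => z * c l)) => l a x y.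
  by rewrite mulrDl scalerAl.
move=> u; move: c; apply: tenf_eq.
- exact: multilinear_comp (@mulT_linearr n _) (tenf_multilinear n).
- split=> [b b' bb|k b]; first by apply: eq_tenf => k; rewrite bb.
  apply: (mul_updl b (fun l z => e (u l) * z)) => l a x y.
  by rewrite mulrDr scalerAr.
move=> v; rewrite mulT_lext !tenf_e lextU lextU.
by apply: eq_tenf => k; rewrite !tnth_mktuple.
Qed.

End Tensors.

(** * Placing a tensor in two adjacent factors *)

Definition ins (A : Type) d (i : nat) (x y : A) (b : 'I_d -> A) : 'I_d -> A :=
  fun k => if k == i.-1 :> nat then x else if k == i :> nat then y else b k.

Definition pair2 (A : Type) (x y : A) : 'I_2 -> A := fun k => if k == ord0 then x else y.

(* [Z] put in the factors [i.-1] and [i] (counted from 0) of the pure tensor [b]. *)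
HB.lock Definition emb (K : comNzRingType) (B : algType K) (I : choiceType)
    (e : I -> B) (co : B -> {malg K[I]}) d (i : nat) (b : 'I_d -> B) (Z : T K I 2) :
    T K I d :=
  lext (fun u : 2.-tuple I => tenf co (ins i (e (tnth u ord0)) (e (tnth u ord_max)) b)) Z.

Fact slot0_lt d i : (1 <= i < d)%N -> (i.-1 < d)%N.
Proof. by lia. Qed.

Fact slot1_lt d i : (1 <= i < d)%N -> (i < d)%N.
Proof. by case/andP. Qed.

Section Embedding.
Variables (K : comNzRingType) (B : algType K) (I : choiceType).
Variables (e : I -> B) (co : B -> {malg K[I]}).
Hypothesis hbasis : is_basisB e co.
Variables (d i : nat).
Hypothesis hi : (1 <= i < d)%N.
Local Notation emb := (emb e co i).
Local Notation tenf := (tenf co).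
Implicit Types (b c : 'I_d -> B) (Z : T K I 2).

Lemma emb_linear b : linear (emb b).
Proof. rewrite emb.unlock; exact: lext_linear. Qed.

Lemma emb_bT b (u : 2.-tuple I) :
  emb b (bT K u) = tenf (ins i (e (tnth u ord0)) (e (tnth u ord_max)) b).
Proof. by rewrite emb.unlock lextU. Qed.

Lemma tuple2_pair2 (u : 2.-tuple I) :
  (fun k => e (tnth u k)) =1 pair2 (e (tnth u ord0)) (e (tnth u ord_max)).
Proof.
move=> k; rewrite /pair2; case: eqP => [->//|nk]; congr (e (tnth u _)).
by apply: val_inj; case: k nk => [[|[|k]] hk] //= nk; case: nk; apply: val_inj.
Qed.

Lemma bT_pair2 (u : 2.-tuple I) :
  bT K u = tenf (pair2 (e (tnth u ord0)) (e (tnth u ord_max))).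
Proof. by rewrite (bT_tenf hbasis) (eq_tenf hbasis (tuple2_pair2 u)). Qed.

Lemma linear_T2_eq (M : lmodType K) (f g : T K I 2 -> M) : linear f -> linear g ->
  (forall x y, f (tenf (pair2 x y)) = g (tenf (pair2 x y))) -> f =1 g.
Proof.
move=> lf lg fg; apply: linear_malg_eq => // u.
by rewrite -[mkmalgU _ _]/(bT K u) bT_pair2 fg.
Qed.

Lemma eq_emb b c Z : (forall k : 'I_d, k != i.-1 :> nat -> k != i :> nat -> b k = c k) ->
  emb b Z = emb c Z.
Proof.
move=> bc; rewrite emb.unlock; apply: eq_lext => u; apply: (eq_tenf hbasis) => k.
by rewrite /ins; case: eqP => // /eqP k1; case: eqP => // /eqP k2; apply: bc.
Qed.

Let k0 : 'I_d := Ordinal (slot0_lt hi).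
Let k1 : 'I_d := Ordinal (slot1_lt hi).

Let k01 : (k0 == k1) = false.
Proof. by apply/eqP => /(congr1 val) /=; lia. Qed.

Lemma ins_upd0 x y z b : ins i z y b =1 upd (ins i x y b) k0 z.
Proof. by move=> k; rewrite /ins /upd -val_eqE /=; case: eqP. Qed.

Lemma ins_upd1 x y z b : ins i x z b =1 upd (ins i x y b) k1 z.
Proof.
move=> k; rewrite /ins /upd -val_eqE /=; case: eqP => [->|]; case: eqP => //.
lia.
Qed.

Lemma pair2_upd0 (x y z : B) : pair2 z y =1 upd (pair2 x y) ord0 z.
Proof. by move=> k; rewrite /pair2 /upd; case: eqP. Qed.

Lemma pair2_upd1 (x y z : B) : pair2 x z =1 upd (pair2 x y) ord_max z.
Proof. by move=> [[|[|k]] hk]. Qed.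

Lemma emb_tenf b x y : emb b (tenf (pair2 x y)) = tenf (ins i x y b).
Proof.
pose F (p : 'I_2 -> B) := emb b (tenf p).
pose G (p : 'I_2 -> B) := tenf (ins i (p ord0) (p ord_max) b).
suff FG : forall p, F p = G p by rewrite [LHS](FG (pair2 x y)).
apply: (tenf_eq hbasis).
- exact: multilinear_comp (emb_linear b) (tenf_multilinear hbasis 2).
- split=> [p q pq|k p a z t]; first by rewrite /G !pq.
  rewrite /G /upd; have [<-|n0] := eqVneq ord0 k.
    by rewrite !(eq_tenf hbasis (ins_upd0 0 _ _ _)) (tenf_multilinear hbasis d).2.
  have [_|n1] := eqVneq ord_max k; last first.
    by case: k n0 n1 => [[|[|k]] hk]; rewrite // -!val_eqE.
  by rewrite !(eq_tenf hbasis (ins_upd1 _ 0 _ _)) (tenf_multilinear hbasis d).2.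
move=> u; rewrite /F /G (tenf_e hbasis) emb_bT; apply: (eq_tenf hbasis) => k.
by rewrite !tnth_mktuple.
Qed.

Lemma ins_id b : ins i (b k0) (b k1) b =1 b.
Proof.
move=> k; rewrite /ins; case: eqP => [kE|_].
  by congr b; apply: val_inj.
by case: eqP => [kE|//]; congr b; apply: val_inj.
Qed.

Lemma emb_upd_linear b Z k : k != k0 -> k != k1 -> linear (fun x => emb (upd b k x) Z).
Proof.
move=> n0 n1 a x y; rewrite emb.unlock -lext_fun_linear; apply: eq_lext => u.
have insC z : ins i (e (tnth u ord0)) (e (tnth u ord_max)) (upd b k z) =1
    upd (ins i (e (tnth u ord0)) (e (tnth u ord_max)) b) k z.
  move=> l; rewrite /ins /upd; case: (eqVneq l k) => [->|//].
  by move: n0 n1; rewrite -!val_eqE /= => /negPf -> /negPf ->.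
rewrite !(eq_tenf hbasis (insC _)) (tenf_multilinear hbasis d).2.
by [].
Qed.

Lemma liftT_linear phi : linear (@liftT K I d i phi).
Proof. exact: lext_linear. Qed.

Lemma liftT_bT (phi : T K I 2 -> T K I 2) (u : d.-tuple I) :
  liftT i phi (bT K u) =
  emb (fun k => e (tnth u k)) (phi (bT K [tuple (tnth u k0); (tnth u k1)])).
Proof.
rewrite /liftT /bT msuppU oner_eq0 big_seq_fset1 mcoeffUU scale1r.
(* Since [i < d], at least two entries remain after dropping [i.-1], so the default branch of
   [liftT] is never reached. *)
rewrite (drop_nth (tnth u k0)) ?size_tuple; last by lia.
rewrite (drop_nth (tnth u k0)) ?size_tuple; last by lia.
have -> : i.-1.+1 = i by lia.
rewrite -(tnth_nth _ u k0) -(tnth_nth _ u k1) emb.unlock; apply: eq_bigr => v _.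
congr (_ *: _); rewrite -[mkmalgU _ _]/(bT K _) (bT_tenf hbasis).
apply: (eq_tenf hbasis) => k; rewrite tnth_mktuple /ins.
by case: eqP => // _; case: eqP.
Qed.

Lemma liftT_tenf (phi : T K I 2 -> T K I 2) b : linear phi ->
  liftT i phi (tenf b) = emb b (phi (tenf (pair2 (b k0) (b k1)))).
Proof.
move=> lphi; move: b; apply: (tenf_eq hbasis).
- exact: multilinear_comp (liftT_linear phi) (tenf_multilinear hbasis d).
- split=> [b c bc|k b].
    by rewrite !bc; apply: eq_emb => k _ _; apply: bc.
  (* A factor in one of the two slots is an argument of [phi]; any other factor stays in the
     surrounding tensor. *)
  have [->|n0] := eqVneq k k0.
    move=> a x y; rewrite /upd eqxx eq_sym k01.
    rewrite !(@eq_emb (fun l => if l == k0 then _ else b l) b); first last.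
    - by move=> l; rewrite -val_eqE => /negPf ->.
    - by move=> l; rewrite -val_eqE => /negPf ->.
    - by move=> l; rewrite -val_eqE => /negPf ->.
    rewrite !(eq_tenf hbasis (pair2_upd0 0 _ _)) (tenf_multilinear hbasis 2).2.
    by rewrite lphi emb_linear.
  have [->|n1] := eqVneq k k1.
    move=> a x y; rewrite /upd eqxx k01.
    rewrite !(@eq_emb (fun l => if l == k1 then _ else b l) b); first last.
    - by move=> l _; rewrite -val_eqE => /negPf ->.
    - by move=> l _; rewrite -val_eqE => /negPf ->.
    - by move=> l _; rewrite -val_eqE => /negPf ->.
    rewrite !(eq_tenf hbasis (pair2_upd1 _ 0 _)) (tenf_multilinear hbasis 2).2.
    by rewrite lphi emb_linear.
  move=> a x y.
  have updk z l : l != k -> upd b k z l = b l by move=> /negPf nl; rewrite /upd nl.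
  rewrite !updk 1?eq_sym //; exact: emb_upd_linear.
move=> u; rewrite (tenf_e hbasis) liftT_bT !tnth_mktuple.
rewrite bT_pair2 !(tnth_nth (u k0)) /=.
by apply: eq_emb => k _ _; rewrite tnth_mktuple.
Qed.

Lemma liftT_emb (phi : T K I 2 -> T K I 2) b Z : linear phi ->
  liftT i phi (emb b Z) = emb b (phi Z).
Proof.
move=> lphi; move: Z; apply: linear_T2_eq.
- exact: linear_comp (liftT_linear phi) (emb_linear b).
- exact: linear_comp (emb_linear b) lphi.
move=> x y; rewrite emb_tenf liftT_tenf //.
have -> : ins i x y b k0 = x by rewrite /ins /= eqxx.
have -> : ins i x y b k1 = y by rewrite /ins /= eqxx; case: eqP => //; lia.
by apply: eq_emb => k /negPf h0 /negPf h1; rewrite /ins h0 h1.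
Qed.

Lemma mulT_emb b c Z Y :
  mulT e co (emb b Z) (emb c Y) = emb (fun k => b k * c k) (mulT e co Z Y).
Proof.
move: Z; apply: linear_T2_eq.
- exact: linear_comp (mulT_linearl e co _) (emb_linear b).
- exact: linear_comp (emb_linear _) (mulT_linearl e co _).
move=> x y; move: Y; apply: linear_T2_eq.
- exact: linear_comp (mulT_linearr e co _) (emb_linear c).
- exact: linear_comp (emb_linear _) (mulT_linearr e co _).
move=> x' y'; rewrite !emb_tenf !(mulT_tenf hbasis).
rewrite (@eq_tenf _ _ _ _ _ hbasis 2 _ (pair2 (x * x') (y * y'))); last first.
  by move=> k; rewrite /pair2; case: eqP.
rewrite emb_tenf; apply: (eq_tenf hbasis) => k.
by rewrite /ins; case: eqP => // _; case: eqP.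
Qed.

Lemma mapT_emb f b Z : linear f ->
  mapT e co f (emb b Z) = emb (fun k => f (b k)) (mapT e co f Z).
Proof.
move=> lf; move: Z; apply: linear_T2_eq.
- exact: linear_comp (mapT_linear e co f (n := d)) (emb_linear b).
- exact: linear_comp (emb_linear _) (mapT_linear e co f (n := 2)).
move=> x y; rewrite emb_tenf !(mapT_tenf hbasis) //.
rewrite (@eq_tenf _ _ _ _ _ hbasis 2 _ (pair2 (f x) (f y))); last first.
  by move=> k; rewrite /pair2; case: eqP.
rewrite emb_tenf; apply: (eq_tenf hbasis) => k.
by rewrite /ins; case: eqP => // _; case: eqP.
Qed.

Lemma tenf_emb b : tenf b = emb b (tenf (pair2 (b k0) (b k1))).
Proof. by rewrite emb_tenf (eq_tenf hbasis (ins_id b)). Qed.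

Lemma placeT_emb Z : placeT e co d i Z = emb (fun => 1) Z.
Proof. by rewrite emb.unlock; apply: eq_bigr => u _; rewrite ten_tenf. Qed.

Lemma oneT_tenf n : oneT co n = tenf (fun => 1).
Proof. by rewrite -ten_tenf. Qed.

Lemma emb_1 : emb (fun => 1) (oneT co 2) = oneT co d.
Proof.
rewrite !oneT_tenf tenf_emb; congr emb; apply: (eq_tenf hbasis) => k.
by rewrite /pair2; case: eqP.
Qed.

(** The unit of [B] need not be a basis vector, so [Z] cannot be read off directly from the
    coordinates of its placement. Multiplying by a pure tensor of basis vectors replaces the
    surrounding units by basis vectors. *)
Lemma placeT_inj : injective (placeT e co d i).
Proof.
suff emb0 Z : placeT e co d i Z = 0 -> Z = 0.
  move=> Z Y ZY; apply/eqP; rewrite -subr_eq0; apply/eqP/emb0.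
  rewrite placeT_emb -scaleN1r addrC emb_linear -!placeT_emb ZY.
  by rewrite scaleN1r addNr.
rewrite placeT_emb => Z0; apply: T_ext => v; rewrite mcoeff0.
(* Any basis index can fill the other slots; the coordinate [v] under inspection supplies one. *)
pose w : 'I_d -> I := fun _ => tnth v ord0.
have Zw0 : emb (fun k => e (w k)) Z = 0.
  have mulT0 x : mulT e co x (0 : T K I d) = 0.
    have := mulT_linearr e co x (-1) 0 0.
    by rewrite scaler0 addr0 scaleN1r addNr.
  rewrite -(mulT0 (emb (fun k => e (w k)) (oneT co 2))) -Z0 mulT_emb.
  rewrite (@eq_emb _ (fun k => e (w k))); last by move=> k _ _; rewrite mulr1.
  congr emb; move: Z {Z0}; apply: linear_T2_eq => //.
    exact: mulT_linearr.
  move=> x y; rewrite oneT_tenf (mulT_tenf hbasis); apply: (eq_tenf hbasis) => k.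
  by rewrite mul1r.
have embE (u : 2.-tuple I) : emb (fun k => e (w k)) (bT K u) =
    bT K [tuple ins i (tnth u ord0) (tnth u ord_max) w k | k < d].
  rewrite emb_bT -(tenf_e hbasis); apply: (eq_tenf hbasis) => k.
  by rewrite /ins; case: eqP => // _; case: eqP.
(* A left inverse of the embedding: it keeps only the indices in the two slots. *)
pose p (x : T K I d) : T K I 2 := lext (fun u : d.-tuple I => bT K [tuple tnth u k0; tnth u k1]) x.
have pE : p (emb (fun k => e (w k)) Z) = Z.
  move: Z {Z0 Zw0}; apply: linear_malg_eq => //.
    exact: linear_comp (lext_linear _) (emb_linear _).
  move=> u; rewrite embE /p lextU; congr bT; apply: eq_from_tnth => k.
  rewrite !tnth_mktuple /ins /= eqxx.
  have -> : (i == i.-1) = false by lia.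
  rewrite eqxx; case: k => [[|[|k]] hk] //; rewrite (tnth_nth (tnth u ord0)) /=;
  by congr tnth; apply: val_inj.
rewrite -pE Zw0 /p /lext msupp0 big_seq_fset0 mcoeff0 //.
Qed.

End Embedding.

(** * The PBW basis and short permutations *)

Section Independence.
Variables (K : comNzRingType) (J : choiceType) (P : finType) (W : algType K).
Variables (iota : {malg K[J]} -> W) (h : P -> W).
Hypothesis iota_lin : linear iota.
Hypothesis hbasis :
  is_basis (fun up : (J * P)%type => iota << 1 *g up.1 >> * h up.2).

(** The coefficients are gathered in one element [m] indexed by pairs; [m] and [0] both represent
    the zero vector, so uniqueness gives [m = 0]. *)
Lemma basis_coef0 (c : P -> {malg K[J]}) :
  \sum_p iota (c p) * h p = 0 -> forall p, c p = 0.
Proof.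
move=> c0; pose F (up : (J * P)%type) := iota << 1 *g up.1 >> * h up.2.
pose m : {malg K[(J * P)%type]} := \sum_p lext (fun u => << 1 *g (u, p) >>) (c p).
have mE u p : m@_(u, p) = (c p)@_u.
  rewrite /m raddf_sum /= (bigD1 p) //= big1 => [|q nqp].
    rewrite addr0 {2}[c p]malg_sumU /lext !raddf_sum; apply: eq_bigr => v _ /=.
    by rewrite !mcoeffZ !mcoeffU xpair_eqE eqxx andbT.
  rewrite /lext raddf_sum big1 //= => v _.
  by rewrite mcoeffZ mcoeffU xpair_eqE (negPf nqp) andbF mulr0.
have F0 : lext F m = 0.
  rewrite -c0 /m -[X in lext _ X](eq_bigr _ (fun p _ => scale1r _)).
  rewrite (linear_on_sum _ _ _ (lext_linear F)); apply: eq_bigr => p _.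
  rewrite scale1r {2}[c p]malg_sumU /lext -/(lext F _).
  rewrite (linear_on_sum _ _ _ (lext_linear F)) (linear_on_sum _ _ _ iota_lin) mulr_suml.
  by apply: eq_bigr => u _; rewrite lextU scalerAl.
have [m' [_ m'uniq]] := hbasis 0.
have F00 : 0 = lext F 0 by rewrite /lext msupp0 big_seq_fset0.
have m0 : m = 0 by rewrite -(m'uniq m) ?(m'uniq 0).
by move=> p; apply/malgP => u; rewrite -mE m0 !mcoeff0.
Qed.

Lemma basis_coef0_seq (qs : seq (P * {malg K[J]})) : uniq [seq q.1 | q <- qs] ->
  \sum_(q <- qs) iota q.2 * h q.1 = 0 -> forall q, q \in qs -> q.2 = 0.
Proof.
have iota_sum (A : Type) (r : seq A) (Q : pred A) (f : A -> {malg K[J]}) :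
    iota (\sum_(a <- r | Q a) f a) = \sum_(a <- r | Q a) iota (f a).
  rewrite -!(big_filter _ Q) -(eq_bigr _ (fun a _ => scale1r (f a))).
  rewrite (linear_on_sum _ _ _ iota_lin).
  by apply: eq_bigr => a _; rewrite scale1r.
move=> uq qs0; pose c p := \sum_(q <- qs | q.1 == p) q.2.
have c0 : forall p, c p = 0.
  apply: basis_coef0; rewrite -[RHS]qs0.
  under eq_bigr do rewrite /c iota_sum mulr_suml.
  rewrite (exchange_big_dep xpredT) //=; apply: eq_bigr => q _.
  by rewrite (big_pred1 q.1) // => p; rewrite /= eq_sym.
move=> q qin; rewrite -[RHS](c0 q.1) /c.
rewrite (big_rem q) //= eqxx big1_seq ?addr0 // => r /andP[/eqP rq rin].
move: uq; rewrite (perm_uniq (perm_map fst (perm_to_rem qin))) /= => /andP[/mapP[]].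
by exists r.
Qed.
End Independence.

(** * Reduced words of length at most three *)

Section ShortPermutations.
Variable d : nat.
Implicit Types (w : seq nat) (i x : nat).

(** The action of [sperm] on plain numbers, so that questions about short words become linear
    arithmetic. *)
Definition swap_nat x i := if x == i.-1 then i else if x == i then i.-1 else x.

Lemma sperm_val i (x : 'I_d) : (1 <= i < d)%N -> sperm d i x = swap_nat x i :> nat.
Proof.
move=> hi; rewrite /sperm; have lt1 : (i.-1 < d)%N by lia.
have lt2 : (i < d)%N by lia.
rewrite !insubT /= /swap_nat.
case: tpermP => [->|->|/eqP n1 /eqP n2] /=; rewrite ?eqxx //.
  by case: eqP => //; lia.
by move: n1 n2; rewrite -!val_eqE /= => /negPf -> /negPf ->.
Qed.

Lemma wperm_val w (x : 'I_d) : valid_word d w -> wperm d w x = foldl swap_nat x w :> nat.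
Proof.
elim: w x => [|i w IH] x; first by rewrite /wperm big_nil perm1.
move=> /= /andP[hi vw].
by rewrite /wperm big_cons permM -/(wperm d w) IH // sperm_val.
Qed.

Lemma reduced_val w w0 : valid_word d w0 -> reduced_expr w (wperm d w0) ->
  [/\ valid_word d w, (size w <= size w0)%N &
    forall x, (x < d)%N -> foldl swap_nat x w = foldl swap_nat x w0].
Proof.
move=> v0 [vw [we wmin]]; split=> // [|x xd]; first exact: wmin.
by rewrite -[x]/(val (Ordinal xd)) -!wperm_val // we.
Qed.

Lemma wperm_neq w w' x : valid_word d w -> valid_word d w' -> (x < d)%N ->
  foldl swap_nat x w != foldl swap_nat x w' -> wperm d w != wperm d w'.
Proof.
move=> vw vw' xd; apply: contra => /eqP ww.
by rewrite -[x]/(val (Ordinal xd)) -!wperm_val // ww.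
Qed.

Variant swap_spec x i : nat -> Type :=
| SwapUp of x = i.-1 : swap_spec x i i
| SwapDown of x = i & x <> i.-1 : swap_spec x i i.-1
| SwapId of x <> i & x <> i.-1 : swap_spec x i x.

Lemma swapP x i : swap_spec x i (swap_nat x i).
Proof.
by rewrite /swap_nat; case: eqP => ?; [|case: eqP => ?]; constructor.
Qed.

(* Forgetting that fixed points avoid [i] and [i.-1] keeps the case analyses below small. *)
Variant step_spec x i : nat -> Type :=
| StepUp of i = x.+1 : step_spec x i x.+1
| StepDown of i = x : step_spec x i x.-1
| StepId : step_spec x i x.

Lemma stepP x i : (0 < i)%N -> step_spec x i (swap_nat x i).
Proof.
move=> i0; case: swapP => [xi|xi _|_ _]; last exact: StepId.
  by rewrite {2}(_ : i = x.+1); [apply: StepUp|]; lia.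
by rewrite -{2}xi; apply: StepDown.
Qed.

(** The PBW basis uses an unknown choice of reduced words; this lemma and its analogues for longer
    words determine that choice where it matters. *)
Lemma reduced_0 w : reduced_expr w (1%g : 'S_d) -> w = [::].
Proof.
rewrite (_ : 1%g = wperm d [::]); last by rewrite /wperm big_nil.
by case/reduced_val => // _; case: w.
Qed.

Lemma reduced_1 w i : (1 <= i < d)%N -> reduced_expr w (wperm d [:: i]) -> w = [:: i].
Proof.
move=> hi /reduced_val[|vw sw wE]; first by rewrite /= hi.
have := wE i.-1; case: w vw sw {wE} => [|a [|b w]] //= vw _.
  by case: swapP; lia.
by do 2 case: swapP => /=; intros; congr [:: _]; lia.
Qed.

Lemma reduced_2 w i j : (1 <= i < d)%N -> (1 <= j < d)%N -> i = j.+1 \/ j = i.+1 ->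
  reduced_expr w (wperm d [:: i; j]) -> w = [:: i; j].
Proof.
move=> hi hj ij /reduced_val[|vw sw wE]; first by rewrite /= hi hj.
(* [x] is the point that the product moves by two places. A letter moves a point by at most one
   place, so the path of [x] reveals both letters in order. *)
have [x [y [xd xy xij]]] : exists x y, [/\ (x < d)%N, foldl swap_nat x [:: i; j] = y &
    x = i.-1 /\ j = i.+1 /\ y = i.+1 \/ x = i /\ i = j.+1 /\ y = j.-1].
  case: ij => ij; [exists i, j.-1|exists i.-1, i.+1]; split; try lia;
  by rewrite /=; do 2 (case: swapP => /=); lia.
have := wE x xd; rewrite {}xy; case: w vw sw {wE} => [|a [|b [|c w]]] //= vw _.
- by intros; lia.
- have a0 : (0 < a)%N by lia.
  by clear -hi hj a0 xij; case: (stepP _ a0) => [?|?|] ?; exfalso; lia.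
have a0 : (0 < a)%N by lia.
have b0 : (0 < b)%N by lia.
suff : swap_nat (swap_nat x a) b = y -> a = i /\ b = j by move=> h /h[-> ->].
by clear -hi hj a0 b0 xij; case: (stepP _ a0); case: (stepP _ b0); lia.
Qed.

Lemma reduced_3 w i : (1 <= i)%N -> (i.+1 < d)%N ->
  reduced_expr w (wperm d [:: i; i.+1; i]) -> w = [:: i; i.+1; i] \/ w = [:: i.+1; i; i.+1].
Proof.
move=> hi hj /reduced_val[|vw sw wE]; first by rewrite /=; lia.
(* The product exchanges the outer points [i.-1] and [i.+1]; their two paths leave only the two
   words of the braid relation. *)
have := wE i.-1; have := wE i.+1.
have E1 : foldl swap_nat i.-1 [:: i; i.+1; i] = i.+1.
  by rewrite /=; do 3 case: swapP => /=; lia.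
have E2 : foldl swap_nat i.+1 [:: i; i.+1; i] = i.-1.
  by rewrite /=; do 3 case: swapP => /=; lia.
rewrite E1 E2 => /(_ hj) w2 /(_ ltac:(lia)) w1.
case: w vw sw {wE} w1 w2 => [|a [|b [|c [|k w]]]] //= vw _.
- by move=> w1; exfalso; lia.
- by case: swapP; intros; exfalso; lia.
- have a0 : (0 < a)%N by lia.
  have b0 : (0 < b)%N by lia.
  move=> w1 w2; exfalso; clear -a0 b0 w1 w2 hi; move: w1 w2.
  case: (stepP i.-1 a0) => [?|?|]; case: (stepP _ b0) => [?|?|]; try lia;
  by case: (stepP i.+1 a0) => [?|?|]; case: (stepP _ b0) => [?|?|]; lia.
have a0 : (0 < a)%N by lia.
have b0 : (0 < b)%N by lia.
have c0 : (0 < c)%N by lia.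
move=> w1 w2.
suff : (a = i /\ b = i.+1 /\ c = i) \/ (a = i.+1 /\ b = i /\ c = i.+1).
  by case=> [[-> [-> ->]]|[-> [-> ->]]]; [left|right].
clear -a0 b0 c0 w1 w2 hi; move: w1 w2.
case: (stepP i.-1 a0) => [?|?|]; case: (stepP _ b0) => [?|?|];
  case: (stepP _ c0) => [?|?|] w1; try (exfalso; lia);
case: (stepP i.+1 a0) => [?|?|]; case: (stepP _ b0) => [?|?|];
  case: (stepP _ c0) => [?|?|]; lia.
Qed.

Lemma wperm_short_uniq i : (1 <= i)%N -> (i.+1 < d)%N ->
  uniq (map (wperm d) [:: [::]; [:: i]; [:: i.+1]; [:: i; i.+1]; [:: i.+1; i]; [:: i; i.+1; i]]).
Proof.
move=> hi hi1; set ws := [:: _; _; _; _; _; _].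
have lt0 : (i.-1 < d)%N by lia.
have lt1 : (i < d)%N by lia.
(* A permutation of the three points [i.-1], [i], [i.+1] is determined by the images of the first
   two. *)
pose ev (p : 'S_d) := (val (p (Ordinal lt0)), val (p (Ordinal lt1))).
have valid_ws : all (valid_word d) ws by rewrite /= hi lt1 hi1.
apply: (@map_uniq _ _ ev); rewrite -map_comp (_ : map _ ws =
  [seq (foldl swap_nat i.-1 w, foldl swap_nat i w) | w <- ws]); last first.
  apply/eq_in_map => w /(allP valid_ws) vw.
  by rewrite /ev /= !wperm_val.
move: hi; rewrite /ws; clear; case: i => [//|k _] /=.
have e1 n : swap_nat n n.+1 = n.+1 by case: swapP; lia.
have e2 n : swap_nat n.+1 n.+1 = n by case: swapP; lia.
have e3 n : swap_nat n n.+2 = n by case: swapP; lia.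
have e4 n : swap_nat n.+2 n.+1 = n.+2 by case: swapP; lia.
rewrite !(e1, e2, e3, e4) /= !inE !xpair_eqE.
by rewrite !eqn_leq !ltnn !leqnn !leqnSn /= ?andbF; lia.
Qed.
End ShortPermutations.

(** * Generators with quadratic relations *)

Inductive zexpr := ZVar of nat | ZAdd of zexpr & zexpr | ZOpp of zexpr | ZZero.

Fixpoint zeval (U : zmodType) (env : seq U) (t : zexpr) : U :=
  match t with
  | ZVar n => env`_n
  | ZAdd t1 t2 => zeval env t1 + zeval env t2
  | ZOpp t1 => - zeval env t1
  | ZZero => 0
  end.

Fixpoint zcoef (t : zexpr) (i : nat) : int :=
  match t with
  | ZVar n => (n == i)%:R
  | ZAdd t1 t2 => zcoef t1 i + zcoef t2 i
  | ZOpp t1 => - zcoef t1 i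
  | ZZero => 0
  end.

Lemma zeval_coef (U : zmodType) (env : seq U) t :
  zeval env t = \sum_(i < size env) env`_i *~ zcoef t i.
Proof.
elim: t => [n|t1 IH1 t2 IH2|t1 IH1|] /=.
- have [ltn|len] := ltnP n (size env); last first.
    rewrite nth_default // big1 // => i _.
    by rewrite (_ : (n == i) = false) //; have := ltn_ord i; lia.
  rewrite (bigD1 (Ordinal ltn)) //= eqxx big1 ?addr0 // => i.
  by rewrite -val_eqE eq_sym /= => /negPf ->.
- by rewrite IH1 IH2 -big_split; apply: eq_bigr => i _; rewrite mulrzDr.
- by rewrite IH1 -sumrN; apply: eq_bigr => i _; rewrite mulrNz.
- by rewrite big1.
Qed.

(** Soundness of the reflection behind [abelian]. The rings below are noncommutative; once products
    are distributed, only additive rearrangements remain. *)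
Lemma zeval_eq (U : zmodType) (env : seq U) t1 t2 :
  all (fun i => zcoef t1 i == zcoef t2 i) (seq.iota 0 (size env)) ->
  zeval env t1 = zeval env t2.
Proof.
move=> /allP h; rewrite !zeval_coef; apply: eq_bigr => i _.
have hi : val i \in seq.iota 0 (size env) by rewrite mem_iota ltn_ord.
by rewrite (eqP (h _ hi)).
Qed.

Ltac zindex x env :=
  match env with
  | ?y :: _ => let _ := match goal with _ => unify x y end in constr:(0%N)
  | _ :: ?env' => let n := zindex x env' in constr:(n.+1)
  end.
Ltac zatoms t env :=
  lazymatch t with
  | @Algebra.add _ ?x ?y => let env' := zatoms x env in zatoms y env'
  | @Algebra.opp _ ?x => zatoms x env
  | @Algebra.zero _ => env
  | _ => match env with
         | _ => let n := zindex t env in env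
         | _ => constr:(t :: env)
         end
  end.
Ltac zreify t env :=
  lazymatch t with
  | @Algebra.add _ ?x ?y =>
      let a := zreify x env in let b := zreify y env in constr:(ZAdd a b)
  | @Algebra.opp _ ?x => let a := zreify x env in constr:(ZOpp a)
  | @Algebra.zero _ => constr:(ZZero)
  | _ => let n := zindex t env in constr:(ZVar n)
  end.
(* Identities of abelian groups; products and images of functions are atoms. *)
Ltac abelian :=
  lazymatch goal with
  | |- @eq ?U ?x ?y =>
      let env := zatoms x (@nil U) in let env := zatoms y env in
      let a := zreify x env in let b := zreify y env in
      exact (@zeval_eq _ env a b isT)
  end.

Lemma eq_sub_iff (U : zmodType) (x y x' y' : U) : x - y = x' - y' -> x = y <-> x' = y'.
Proof.
by move=> E; split=> /eqP; rewrite -subr_eq0 => /eqP h; apply/eqP; rewrite -subr_eq0 -?E ?h // E h.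
Qed.

(** Transfers a known equation to one that differs by an additive rearrangement; the second premise
    is the part left to [abelian]. *)
Lemma eq_of_sub_eq (U : zmodType) (x y x' y' : U) : x = y -> x' - y' = x - y -> x' = y'.
Proof. by move=> -> /eqP; rewrite subrr subr_eq0 => /eqP. Qed.

Section Additive.
Variables (U U' : zmodType) (f : U -> U').
Hypothesis fB : forall x y, f (x - y) = f x - f y.

Lemma additive_0 : f 0 = 0.
Proof. by rewrite -(subr0 0) fB subrr. Qed.

Lemma additive_N x : f (- x) = - f x.
Proof. by rewrite -sub0r fB additive_0 sub0r. Qed.

Lemma additive_D x y : f (x + y) = f x + f y.
Proof. by rewrite -{1}[y]opprK fB additive_N opprK. Qed.
End Additive.

(** The computation by which two shifted endomorphisms undo each other on a generator: the two
    copies of [b] cancel. *)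
Lemma additive_unshift (U : zmodType) (g : U -> U) (h a b : U) :
  (forall x y, g (x - y) = g x - g y) -> g h = - h + b -> g a = b -> g (- h + a) = h.
Proof. by move=> gB gh ga; rewrite (additive_D gB) (additive_N gB) gh ga; abelian. Qed.

(** * One or two generators over an abstract coefficient ring *)

Section QuadraticGenerators.
Variables (V W : pzRingType) (iota : V -> W).
Hypotheses (iotaB : forall x y, iota (x - y) = iota x - iota y)
  (iotaM : forall x y, iota (x * y) = iota x * iota y) (iota1 : iota 1 = 1).
Implicit Types (s r x y : V) (sg rh : V -> V).

Let iota0 := additive_0 iotaB.
Let iotaD := additive_D iotaB.
Let iotaN := additive_N iotaB.

(** What a single [H i] retains once tensors are forgotten; [free2] is the independence of [1] and
    [H] contained in the PBW basis. *)
Record quad_gen (H : W) s r sg rh : Prop := QuadGen {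
  sgB : forall x y, sg (x - y) = sg x - sg y;
  rhB : forall x y, rh (x - y) = rh x - rh y;
  quad : H * H = iota s * H + iota r;
  push : forall x, H * iota x = iota (sg x) * H + iota (rh x);
  free2 : forall x y, iota x + iota y * H = 0 -> x = 0 /\ y = 0 }.

Section OneGenerator.
Variables (H : W) (s r : V) (sg rh : V -> V).
Hypothesis hH : quad_gen H s r sg rh.

Lemma free2_eq x y x' y' : iota x + iota y * H = iota x' + iota y' * H -> x = x' /\ y = y'.
Proof.
move/eqP; rewrite -subr_eq0 opprD addrACA -iotaB -mulrBl -iotaB => /eqP/(free2 hH).
by case=> /eqP + /eqP; rewrite !subr_eq0 => /eqP + /eqP.
Qed.

Lemma iota_inj : injective iota.
Proof.
move=> x y xy; have [|//] := @free2_eq x 0 y 0; by rewrite xy.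
Qed.

Lemma sg_rh_1 : sg 1 = 1 /\ rh 1 = 0.
Proof.
have := push hH 1; rewrite iota1 mulr1 addrC => E.
have [] := @free2_eq 0 1 (rh 1) (sg 1); last by move=> <- <-.
by rewrite iota0 add0r iota1 mul1r.
Qed.

(** Compare [H (x y)] with [(H x) y]: [sg] is multiplicative and [rh] a twisted derivation. *)
Lemma sg_rh_mul x y : sg (x * y) = sg x * sg y /\ rh (x * y) = sg x * rh y + rh x * y.
Proof.
have [] // := @free2_eq (rh (x * y)) (sg (x * y)) (sg x * rh y + rh x * y) (sg x * sg y).
rewrite addrC -(push hH) iotaM mulrA (push hH) mulrDl -mulrA (push hH) mulrDr mulrA.
by rewrite !iotaD !iotaM -addrA addrC.
Qed.

Lemma sgM x y : sg (x * y) = sg x * sg y. Proof. exact: (sg_rh_mul x y).1. Qed.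
Lemma rhM x y : rh (x * y) = sg x * rh y + rh x * y.
Proof. exact: (sg_rh_mul x y).2. Qed.

(* The [H]-coefficient of [H * (H * H) = (H * H) * H]. *)
Lemma cube_coef : sg s * s + rh s + sg r = s * s + r.
Proof.
have [] // := @free2_eq (sg s * r + rh r) (sg s * s + rh s + sg r) (s * r) (s * s + r).
transitivity (H * (H * H)).
  rewrite (quad hH) mulrDr mulrA !(push hH) mulrDl -mulrA (quad hH) mulrDr mulrA.
  rewrite !iotaD !iotaM !mulrDl; abelian.
rewrite mulrA (quad hH) mulrDl -mulrA (quad hH) mulrDr mulrA.
by rewrite iotaD mulrDl !iotaM; abelian.
Qed.

(** The shift [a] is left free because [#] uses [s] and its inverse uses the preimage of [s]. *)
Lemma shift_push a x y : (- H + iota a) * iota x = iota (sg x) * (- H + iota a) + iota y <->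
  a * x - sg x * a = rh x + y.
Proof.
rewrite mulrDl mulrDr mulNr (push hH) mulrN -!iotaM.
split=> [E|/(congr1 iota)]; last rewrite iotaB iotaD => E.
  by apply: iota_inj; rewrite iotaB iotaD; apply: (eq_of_sub_eq E); abelian.
by apply: (eq_of_sub_eq E); abelian.
Qed.

Lemma shift_square a s' r' :
  (- H + iota a) * (- H + iota a) = iota s' * (- H + iota a) + iota r' <->
  s - sg a - a = - s' /\ r - rh a + a * a = s' * a + r'.
Proof.
have -> : (- H + iota a) * (- H + iota a) =
    iota (r - rh a + a * a) + iota (s - sg a - a) * H.
  rewrite mulrDl !mulrDr !mulNr !mulrN (quad hH) (push hH) !(iotaB, iotaD) iotaM !mulrBl.
  abelian.
have -> : iota s' * (- H + iota a) + iota r' = iota (s' * a + r') + iota (- s') * H.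
  by rewrite mulrDr iotaD iotaM iotaN mulNr mulrN; abelian.
by split=> [/free2_eq[-> ->]|[-> ->]].
Qed.

End OneGenerator.

(* Normal form with respect to the PBW basis of a parabolic subgroup of type A_2. *)
Definition nf (H H' : W) (x0 x1 x2 x12 x21 x121 : V) : W :=
  iota x0 + iota x1 * H + iota x2 * H' + iota x12 * (H * H') + iota x21 * (H' * H)
  + iota x121 * (H * H' * H).

Record quad_pair (H : W) s r sg rh (H' : W) s' r' sg' rh' : Prop := QuadPair {
  qg1 : quad_gen H s r sg rh;
  qg2 : quad_gen H' s' r' sg' rh';
  braid : H * H' * H = H' * H * H';
  free6 : forall x0 x1 x2 x12 x21 x121, nf H H' x0 x1 x2 x12 x21 x121 = 0 ->
    [/\ x0 = 0, x1 = 0 & x2 = 0] /\ [/\ x12 = 0, x21 = 0 & x121 = 0] }.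

(** The braid relation makes the longest basis element symmetric, so each identity proved for [H]
    also holds with the generators exchanged. *)
Lemma quad_pair_sym H s r sg rh H' s' r' sg' rh' :
  quad_pair H s r sg rh H' s' r' sg' rh' -> quad_pair H' s' r' sg' rh' H s r sg rh.
Proof.
move=> hp; split; [exact: qg2 hp|exact: qg1 hp|by rewrite (braid hp)|].
move=> x0 x1 x2 x12 x21 x121 h; have [|[-> -> ->] [-> -> ->]] // :=
  @free6 _ _ _ _ _ _ _ _ _ _ hp x0 x2 x1 x21 x12 x121.
by rewrite -h /nf (braid hp); abelian.
Qed.

Section TwoGenerators.
Variables (H : W) (s r : V) (sg rh : V -> V) (H' : W) (s' r' : V) (sg' rh' : V -> V).
Hypothesis hp : quad_pair H s r sg rh H' s' r' sg' rh'.
Local Notation nfH := (nf H H').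

Let h1 := qg1 hp.
Let h2 := qg2 hp.

Lemma nf_sym x0 x1 x2 x12 x21 x121 :
  nfH x0 x1 x2 x12 x21 x121 = nf H' H x0 x2 x1 x21 x12 x121.
Proof. by rewrite /nf (braid hp); abelian. Qed.

Lemma nf_inj x0 x1 x2 x12 x21 x121 y0 y1 y2 y12 y21 y121 :
  nfH x0 x1 x2 x12 x21 x121 = nfH y0 y1 y2 y12 y21 y121 ->
  [/\ x0 = y0, x1 = y1 & x2 = y2] /\ [/\ x12 = y12, x21 = y21 & x121 = y121].
Proof.
move=> E; have [] : [/\ x0 - y0 = 0, x1 - y1 = 0 & x2 - y2 = 0] /\
    [/\ x12 - y12 = 0, x21 - y21 = 0 & x121 - y121 = 0].
  apply: (free6 hp); rewrite /nf !iotaB !mulrBl.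
  by apply: (eq_of_sub_eq E); rewrite /nf; abelian.
by case=> [? ? ?] [? ? ?]; split; split; apply/eqP; rewrite -subr_eq0; apply/eqP.
Qed.

(** The basis splits into the pairs [(1, H)], [(H', H H')], [(H' H, H H' H)], and [H] acts on the
    coefficients of each pair by the rank one formula. *)
Lemma nf_mull x0 x1 x2 x12 x21 x121 :
  H * nfH x0 x1 x2 x12 x21 x121 =
  nfH (rh x0 + sg x1 * r) (sg x0 + sg x1 * s + rh x1) (rh x2 + sg x12 * r)
     (sg x2 + sg x12 * s + rh x12) (rh x21 + sg x121 * r)
     (sg x21 + sg x121 * s + rh x121).
Proof.
have HH : forall z, H * (H * z) = iota s * (H * z) + iota r * z.
  by move=> z; rewrite mulrA (quad h1) mulrDl -mulrA.
rewrite /nf !mulrDr !(mulrA H (iota _)) !(push h1) !mulrDl -!mulrA.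
rewrite !(quad h1) !HH !(mulrDr, iotaD, iotaM, mulrDl) -!mulrA.
abelian.
Qed.

Lemma nf_scale a x0 x1 x2 x12 x21 x121 : iota a * nfH x0 x1 x2 x12 x21 x121 =
  nfH (a * x0) (a * x1) (a * x2) (a * x12) (a * x21) (a * x121).
Proof. by rewrite /nf !mulrDr !mulrA -!iotaM. Qed.

Lemma nf_sub x0 x1 x2 x12 x21 x121 y0 y1 y2 y12 y21 y121 :
  nfH x0 x1 x2 x12 x21 x121 - nfH y0 y1 y2 y12 y21 y121 =
  nfH (x0 - y0) (x1 - y1) (x2 - y2) (x12 - y12) (x21 - y21) (x121 - y121).
Proof. by rewrite /nf !iotaB !mulrBl; abelian. Qed.

End TwoGenerators.

Section TwistedGenerators.
Variables (H : W) (s r : V) (sg rh : V -> V) (H' : W) (s' r' : V) (sg' rh' : V -> V).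
Hypothesis hp : quad_pair H s r sg rh H' s' r' sg' rh'.
Local Notation nfH := (nf H H').

Let h1 := qg1 hp.
Let h2 := qg2 hp.
Let sg0 := additive_0 (sgB h1).
Let rh0 := additive_0 (rhB h1).
Let sg0' := additive_0 (sgB h2).
Let rh0' := additive_0 (rhB h2).
Let sg1 := (sg_rh_1 h1).1.
Let rh1 := (sg_rh_1 h1).2.
Let sg1' := (sg_rh_1 h2).1.
Let rh1' := (sg_rh_1 h2).2.

Lemma nf_mull' x0 x1 x2 x12 x21 x121 :
  H' * nfH x0 x1 x2 x12 x21 x121 =
  nfH (rh' x0 + sg' x2 * r') (rh' x1 + sg' x21 * r') (sg' x0 + sg' x2 * s' + rh' x2)
     (rh' x12 + sg' x121 * r') (sg' x1 + sg' x21 * s' + rh' x21)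
     (sg' x12 + sg' x121 * s' + rh' x121).
Proof. by rewrite (nf_sym hp) (nf_mull (quad_pair_sym hp)) -(nf_sym hp). Qed.

Let nf0 := (mul0r, mulr0, addr0, add0r, sub0r, subr0, sg0, rh0, sg0', rh0', iota0).
Let nf1 := (sg1, rh1, sg1', rh1', iota1, mul1r, mulr1).

(* Coefficients in [H H' (H H) = H' H' H H']. *)
Lemma sg_sg_s : sg (sg' s) = s' /\ rh (sg' s) = 0.
Proof.
have E : H * (H' * (H * H)) = H' * (H' * (H * H')).
  by rewrite (mulrA H' H H') -(braid hp) !mulrA (braid hp).
have HH : H * H = nfH r s 0 0 0 0 by rewrite /nf !nf0 (quad h1) addrC.
have HHH : H' * (H * H') = nfH 0 0 0 0 0 1.
  by rewrite /nf !nf0 iota1 mul1r (braid hp) mulrA.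
move: E; rewrite HH HHH nf_mull' (nf_mull hp) nf_mull' => /(nf_inj hp).
by rewrite !(nf0, nf1) => -[_ [_ ? ?]].
Qed.

End TwistedGenerators.

Section Shifts.
Variables (H : W) (s r : V) (sg rh : V -> V) (H' : W) (s' r' : V) (sg' rh' : V -> V).
Hypothesis hp : quad_pair H s r sg rh H' s' r' sg' rh'.
Local Notation nfH := (nf H H').

Let h1 := qg1 hp.
Let h2 := qg2 hp.
Let sg0 := additive_0 (sgB h1).
Let rh0 := additive_0 (rhB h1).
Let sg0' := additive_0 (sgB h2).
Let rh0' := additive_0 (rhB h2).
Let nf0 := (mul0r, mulr0, addr0, add0r, sub0r, subr0, sg0, rh0, sg0', rh0', iota0).
Let nf1 := ((sg_rh_1 h1).1, (sg_rh_1 h1).2, (sg_rh_1 h2).1, (sg_rh_1 h2).2, iota1,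
  mul1r, mulr1).

(* The top coefficient of [H' H (H' H') H = H (H' H') H H']. *)
Lemma mul_s_s : s * s' = sg s' * s + rh s'.
Proof.
have E : H' * (H * (H' * (H' * H))) = H * (H' * (H' * (H * H'))).
  by rewrite (mulrA H' H H') -(braid hp) !mulrA -(braid hp).
have HH : H' * H = nfH 0 0 0 0 1 0 by rewrite /nf !nf0 iota1 mul1r.
have HHH : H' * (H * H') = nfH 0 0 0 0 0 1.
  by rewrite /nf !nf0 iota1 mul1r (braid hp) mulrA.
move: E; rewrite HH HHH !(nf_mull' hp, nf_mull hp) => /(nf_inj hp).
rewrite !(nf0, nf1) (sg_sg_s (quad_pair_sym hp)).1 (sg_sg_s (quad_pair_sym hp)).2 addr0.
by case=> _ [].
Qed.

Lemma shift_braid_expand a b :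
  (- H + iota a) * ((- H' + iota b) * (- H + iota a)) =
  nfH (a * (b * a - rh' a) - rh (b * a - rh' a) + sg b * r)
      (sg b * s + rh b - sg (b * a - rh' a) - a * b)
      (rh (sg' a) - a * sg' a) (sg (sg' a)) a (- 1).
Proof.
have E1 : - H + iota a = nfH a (- 1) 0 0 0 0.
  by rewrite /nf !nf0 iotaN iota1 mulN1r addrC.
have mul_shift c d z : (- c + d) * z = d * z - c * z :> W by rewrite mulrDl mulNr addrC.
rewrite {2}E1 (mul_shift H') (nf_mull' hp) nf_scale nf_sub.
rewrite mul_shift (nf_mull hp) nf_scale nf_sub.
rewrite !(additive_N (sgB h1), additive_N (rhB h1), additive_N (sgB h2), additive_N (rhB h2)).
rewrite !(nf0, nf1, oppr0, mulrN, mulrN1, opprK, mulNr) !(additive_N (sgB h1), additive_N (rhB h1)).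
rewrite ?(mulNr, opprK).
congr nf; abelian.
Qed.

End Shifts.

Section ShiftedBraid.
Variables (H : W) (s r : V) (sg rh : V -> V) (H' : W) (s' r' : V) (sg' rh' : V -> V).
Hypothesis hp : quad_pair H s r sg rh H' s' r' sg' rh'.

Let h1 := qg1 hp.
Let h2 := qg2 hp.

Lemma shift_braid_nf a b :
  (- H' + iota b) * ((- H + iota a) * (- H' + iota b)) =
  nf H H' (b * (a * b - rh b) - rh' (a * b - rh b) + sg' a * r')
      (rh' (sg b) - b * sg b)
      (sg' a * s' + rh' a - sg' (a * b - rh b) - b * a)
      b (sg' (sg b)) (- 1).
Proof.
by rewrite (shift_braid_expand (quad_pair_sym hp)) (nf_sym hp).
Qed.

(* By [mul_s_s] and [sg_sg_s], all coefficients but the constant ones agree. *)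
Lemma shift_braid :
  (- H + iota s) * (- H' + iota s') * (- H + iota s) =
  (- H' + iota s') * (- H + iota s) * (- H' + iota s') <->
  s * s' * s + sg s' * r = s' * s * s' + sg' s * r'.
Proof.
have [sE rE] := sg_sg_s hp; have [sE' rE'] := sg_sg_s (quad_pair_sym hp).
have mE := mul_s_s hp; have mE' := mul_s_s (quad_pair_sym hp).
have rh_s' : rh s' = s * s' - sg s' * s by rewrite mE; abelian.
have rh_s : rh' s = s' * s - sg' s * s' by rewrite mE'; abelian.
have ba : s' * s - rh' s = sg' s * s' by rewrite rh_s; abelian.
have ba' : s * s' - rh s' = sg s' * s by rewrite rh_s'; abelian.
rewrite -!mulrA (shift_braid_expand hp) shift_braid_nf ba ba'.
rewrite !(sgM h1, sgM h2, rhM h1, rhM h2) sE rE sE' rE' -mE -mE'.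
rewrite !mul0r !addr0 rh_s rh_s'.
(* The constant coefficients share the terms [s * (sg' s * s')] and [s' * (sg s' * s)]; cancelling
   them and moving the other cubic terms across yields (3). *)
have cE : s * (sg' s * s') - s' * (s * s' - sg s' * s) + sg s' * r =
    s' * (sg s' * s) - s * (s' * s - sg' s * s') + sg' s * r' <->
    s * (s' * s) + sg s' * r = s' * (s * s') + sg' s * r'.
  by apply: eq_sub_iff; rewrite !mulrBr; abelian.
rewrite -cE; split=> [/(nf_inj hp)[[] // ->]|->]; congr nf; abelian.
Qed.

Lemma hom_shift_braid (g : W -> W) : (forall a b : W, g (a * b) = g a * g b) ->
  g H = - H + iota s -> g H' = - H' + iota s' ->
  s * s' * s + sg s' * r = s' * s * s' + sg' s * r'.
Proof.
by move=> gM gH gH'; apply/shift_braid; rewrite -gH -gH' -!gM (braid hp).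
Qed.
End ShiftedBraid.

(** * Twisting the coefficients by an automorphism [sh] with inverse [ta] *)

Section Sharp.
Variables (sh ta : V -> V).
Hypotheses (shB : forall x y, sh (x - y) = sh x - sh y)
  (shM : forall x y, sh (x * y) = sh x * sh y) (shK : cancel sh ta) (taK : cancel ta sh).

Let taB x y : ta (x - y) = ta x - ta y.
Proof. by apply: (can_inj shK); rewrite shB !taK. Qed.

Let taM x y : ta (x * y) = ta x * ta y.
Proof. by apply: (can_inj shK); rewrite shM !taK. Qed.

Let ta0 := additive_0 taB.
Let taD := additive_D taB.

(** Conditions (1) and (2) for one generator, read in the abstract coefficient ring. *)
Definition sharp_compat s r sg rh :=
  [/\ sg r = sh r, sg s = sh s &
    forall x, sg (sh x) = sh (sg x) /\ s * sh x - sg (sh x) * s = rh (sh x) + sh (rh x)].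

Section SharpGenerator.
Variables (H : W) (s r : V) (sg rh : V -> V).
Hypothesis hH : quad_gen H s r sg rh.

Lemma sharp_compatP : sharp_compat s r sg rh <->
  (- H + iota s) * (- H + iota s) = iota (sh s) * (- H + iota s) + iota (sh r) /\
  forall x, (- H + iota s) * iota (sh x) =
    iota (sh (sg x)) * (- H + iota s) + iota (sh (rh x)).
Proof.
have sq : sg s = sh s -> (- H + iota s) * (- H + iota s) =
    iota (sh s) * (- H + iota s) + iota (sh r) <-> sg r = sh r.
  move=> sE; rewrite (shift_square hH) sE; split=> [[_ E]|rE].
    move: (cube_coef hH); rewrite sE => E'.
    by apply: (eq_of_sub_eq E'); apply: (eq_of_sub_eq E); abelian.
  split; first by abelian.
  move: (cube_coef hH); rewrite sE rE => E'; apply: (eq_of_sub_eq (esym E')); abelian.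
split=> [[rE sE c2]|[E1 E2]].
  split=> [|x]; first exact/(sq sE).
  by have [<- c2x] := c2 x; apply/(shift_push hH).
have sE : sg s = sh s.
  have [E _] := (shift_square hH _ _ _).1 E1.
  by apply: (eq_of_sub_eq (esym E)); abelian.
split=> //; first exact/(sq sE).
(* The coefficient of [H] must be compared first: [shift_push] applies only once [sh (sg x)] has
   been replaced by [sg (sh x)]. *)
move=> x; have c : sg (sh x) = sh (sg x).
  have := E2 x; rewrite mulrDl mulrDr mulNr (push hH) mulrN -!iotaM => E.
  have [|_ ->] // := @free2_eq _ _ _ _ _ hH (rh (sh x)) (sg (sh x))
    (s * sh x - sh (sg x) * s - sh (rh x)) (sh (sg x)).
  by rewrite !iotaB; apply/esym; apply: (eq_of_sub_eq E); abelian.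
by split=> //; apply/(shift_push hH); rewrite c E2.
Qed.

Lemma hom_sharp_compat (g : W -> W) :
  (forall a b : W, g (a - b) = g a - g b) -> (forall a b : W, g (a * b) = g a * g b) ->
  (forall x, g (iota x) = iota (sh x)) -> g H = - H + iota s -> sharp_compat s r sg rh.
Proof.
move=> gB gM gi gH; have gD := additive_D gB.
apply/sharp_compatP; split=> [|x]; rewrite -!gH.
  by rewrite -gM (quad hH) gD gM !gi.
by rewrite -gi -gM (push hH) gD gM !gi.
Qed.

Hypothesis hc : sharp_compat s r sg rh.

Lemma sg_ta x : sg (ta x) = ta (sg x).
Proof.
by case: hc => _ _ c2; rewrite -{2}[x]taK (c2 _).1 shK.
Qed.

Lemma sg_ta_s : sg (ta s) = s.
Proof. by case: hc => _ sE _; rewrite sg_ta sE shK. Qed.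

(** This is (2) transported by [ta], using that [sg] commutes with [sh]. *)
Lemma ta_compat x : ta s * x - sg x * ta s = rh x + ta (rh (sh x)).
Proof.
case: hc => _ _ /(_ x)[c /(congr1 ta)].
by rewrite taB taD !taM !shK c shK (addrC (rh x)).
Qed.

(** Applying [ta] to the cube identity eliminates [ta (rh s)] from [ta_compat] at [ta s]. *)
Lemma rh_ta_s : rh (ta s) = r - ta r.
Proof.
have := ta_compat (ta s); rewrite taK sg_ta_s => E.
have E' : ta (sg s * s + rh s + sg r) = ta (s * s + r) by rewrite (cube_coef hH).
have [rE sE _] := hc; move: E'; rewrite !taD !taM sE rE !shK => E'.
apply: (eq_of_sub_eq (esym E)); apply: (eq_of_sub_eq (esym E')); abelian.
Qed.

Lemma unsharp_push x : (- H + iota (ta s)) * iota (ta x) =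
  iota (ta (sg x)) * (- H + iota (ta s)) + iota (ta (rh x)).
Proof. by rewrite -sg_ta; apply/(shift_push hH); rewrite ta_compat taK. Qed.

Lemma unsharp_square : (- H + iota (ta s)) * (- H + iota (ta s)) =
  iota (ta s) * (- H + iota (ta s)) + iota (ta r).
Proof. by apply/(shift_square hH); rewrite sg_ta_s rh_ta_s; split; abelian. Qed.
End SharpGenerator.

Section SharpPair.
Variables (H : W) (s r : V) (sg rh : V -> V) (H' : W) (s' r' : V) (sg' rh' : V -> V).
Hypothesis hp : quad_pair H s r sg rh H' s' r' sg' rh'.
Hypothesis hc : sharp_compat s r sg rh.

(** Applying [ta] to [mul_s_s] reproduces [ta_compat] at [ta s'] except for the term [rh (ta s')],
    which therefore vanishes. *)
Lemma rh_ta_s' : rh (ta s') = 0.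
Proof.
have := ta_compat hc (ta s'); rewrite taK (sg_ta hc) => E.
have := congr1 ta (mul_s_s hp); rewrite taD !taM => E'.
by apply: (eq_of_sub_eq E'); apply: (eq_of_sub_eq (esym E)); abelian.
Qed.

End SharpPair.

Section SharpBraid.
Variables (H : W) (s r : V) (sg rh : V -> V) (H' : W) (s' r' : V) (sg' rh' : V -> V).
Hypothesis hp : quad_pair H s r sg rh H' s' r' sg' rh'.
Hypotheses (hc : sharp_compat s r sg rh) (hc' : sharp_compat s' r' sg' rh').

Lemma unsharp_braid : s * s' * s + sg s' * r = s' * s * s' + sg' s * r' ->
  (- H + iota (ta s)) * (- H' + iota (ta s')) * (- H + iota (ta s)) =
  (- H' + iota (ta s')) * (- H + iota (ta s)) * (- H' + iota (ta s')).
Proof.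
have hp' := quad_pair_sym hp; have [h1 h2 _ _] := hp => E3.
(* This value and its mirror image settle the coefficients of [H] and [H']; [sg_sg_s] evaluates the
   iterated [sg] and kills the last term of [ta_compat]. *)
have rhE : rh' (sg (ta s')) = ta s' * sg (ta s') - ta s * ta s'.
  have := ta_compat hc' (sg (ta s')).
  rewrite (sg_ta hc) (sg_ta hc') (sg_sg_s hp').1 taK (sg_sg_s hp').2.
  by rewrite ta0 addr0 => <-.
have rhE' : rh (sg' (ta s)) = ta s * sg' (ta s) - ta s' * ta s.
  have := ta_compat hc (sg' (ta s)).
  rewrite (sg_ta hc') (sg_ta hc) (sg_sg_s hp).1 taK (sg_sg_s hp).2.
  by rewrite ta0 addr0 => <-.
rewrite -!mulrA (shift_braid_expand hp) (shift_braid_nf hp).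
rewrite (rh_ta_s' hp hc) (rh_ta_s' hp' hc') !subr0 rhE rhE'.
rewrite !(sgM h1, sgM h2, rhM h1, rhM h2) (sg_ta_s hc) (sg_ta_s hc').
rewrite (rh_ta_s' hp hc) (rh_ta_s' hp' hc') (rh_ta_s h1 hc) (rh_ta_s h2 hc').
rewrite !mul0r !addr0.
rewrite (sg_ta hc' s) (sg_ta hc s') (sg_ta hc (sg' s)) (sg_ta hc' (sg s')).
rewrite (sg_sg_s hp).1 (sg_sg_s hp').1.
congr nf; try abelian.
(* Because [rh (ta s)] is [r - ta r], the terms in [r] cancel and the constant coefficients are the
   two sides of (3) under [ta]. *)
have := congr1 ta E3; rewrite !(taD, taM) -!mulrA => E.
by apply: (eq_of_sub_eq E); rewrite !mulrBr; abelian.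
Qed.
End SharpBraid.
End Sharp.
End QuadraticGenerators.

(** Here [p] stands for the placement of two factors among [d]: its injectivity brings the
    conditions back to [B (x) B]. *)
Lemma sharp_compat_pullback (V : pzRingType) (U : zmodType) (m : U -> U -> U) (p : U -> V)
    (sh sg rh : V -> V) (sh0 sg0 rh0 : U -> U) (s r : U) :
  injective p -> (forall x y, p (x - y) = p x - p y) ->
  (forall x y, p x * p y = p (m x y)) -> (forall x, sh (p x) = p (sh0 x)) ->
  (forall x, sg (p x) = p (sg0 x)) -> (forall x, rh (p x) = p (rh0 x)) ->
  sharp_compat sh (p s) (p r) sg rh ->
  (sg0 r = sh0 r /\ sg0 s = sh0 s) /\
  forall b, sg0 (sh0 b) = sh0 (sg0 b) /\
    m s (sh0 b) - m (sg0 (sh0 b)) s = rh0 (sh0 b) + sh0 (rh0 b).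
Proof.
move=> inj pB pM pS pg pr [rE sE c].
split; first by split; apply: inj; rewrite -pg -pS.
move=> b; have [c1 c2] := c (p b); split; apply: inj; first by rewrite -pg -!pS -pg -c1.
by rewrite pB (additive_D pB) -!pM -pr -!pg -!pS c2 pr.
Qed.

(** * The tensor ring and the quantum wreath product *)

Lemma additive_of_linear (K : comNzRingType) (U M : lmodType K) (f : U -> M) :
  linear f -> forall x y, f (x - y) = f x - f y.
Proof. by move=> lf x y; rewrite addrC -scaleN1r lf scaleN1r addrC. Qed.

Lemma linear_add (K : comNzRingType) (U M : lmodType K) (f g : U -> M) :
  linear f -> linear g -> linear (fun x => f x + g x).
Proof. by move=> lf lg a x y; rewrite lf lg scalerDr; abelian. Qed.

Lemma linear_sub (K : comNzRingType) (U M : lmodType K) (f g : U -> M) :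
  linear f -> linear g -> linear (fun x => f x - g x).
Proof. by move=> lf lg a x y; rewrite lf lg scalerBr; abelian. Qed.

Lemma comm_shift (U : pzRingType) (x y a b : U) : x * y = y * x -> x * b = b * x ->
  y * a = a * y -> a * b = b * a -> (- x + a) * (- y + b) = (- y + b) * (- x + a).
Proof.
move=> xy xb ya ab; rewrite !mulrDl !mulrDr !mulNr !mulrN xy xb ya ab; abelian.
Qed.

Section TensorRing.
Variables (K : comNzRingType) (B : algType K) (I : choiceType).
Variables (e : I -> B) (co : B -> {malg K[I]}).
Hypothesis hbasis : is_basisB e co.
Variable d : nat.
Local Notation V := (T K I d).

Lemma mulT_A : associative (@mulT K B I e co d).
Proof.
move=> x y z; move: x; apply: (linear_T_eq hbasis).
- exact: mulT_linearl.
- exact: linear_comp (mulT_linearl e co z) (mulT_linearl e co y).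
move=> a; move: y; apply: (linear_T_eq hbasis).
- exact: linear_comp (mulT_linearr e co _) (mulT_linearl e co z).
- exact: linear_comp (mulT_linearl e co z) (mulT_linearr e co _).
move=> b; move: z; apply: (linear_T_eq hbasis).
- exact: linear_comp (mulT_linearr e co _) (mulT_linearr e co _).
- exact: mulT_linearr.
by move=> c; rewrite !(mulT_tenf hbasis); apply: (eq_tenf hbasis) => k; rewrite mulrA.
Qed.

Lemma mulT_1l : left_id (oneT co d) (@mulT K B I e co d).
Proof.
move=> x; move: x; apply: (linear_T_eq hbasis) => // [|b]; first exact: mulT_linearr.
by rewrite oneT_tenf (mulT_tenf hbasis); apply: (eq_tenf hbasis) => k; rewrite mul1r.
Qed.

Lemma mulT_1r : right_id (oneT co d) (@mulT K B I e co d).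
Proof.
move=> x; move: x; apply: (linear_T_eq hbasis) => // [|b]; first exact: mulT_linearl.
by rewrite oneT_tenf (mulT_tenf hbasis); apply: (eq_tenf hbasis) => k; rewrite mulr1.
Qed.

Lemma mulT_Dl : left_distributive (@mulT K B I e co d) +%R.
Proof. by move=> x y z; have := mulT_linearl e co z 1 x y; rewrite !scale1r. Qed.

Lemma mulT_Dr : right_distributive (@mulT K B I e co d) +%R.
Proof. by move=> x y z; have := mulT_linearr e co x 1 y z; rewrite !scale1r. Qed.

(** The product depends on [e] and [co], and its axioms on [hbasis], so this ring structure is named
    and supplied explicitly. *)
Definition tensor_ring : pzRingType := HB.pack_for pzRingType {malg K[d.-tuple I]}
  (GRing.Zmodule_isPzRing.Build {malg K[d.-tuple I]} mulT_A mulT_1l mulT_1r mulT_Dl mulT_Dr).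
End TensorRing.

Lemma mapT_mulT (K : comNzRingType) (B : algType K) (I : choiceType)
    (e : I -> B) (co : B -> {malg K[I]}) (hbasis : is_basisB e co) d (f : B -> B) :
  linear f -> (forall a b, f (a * b) = f a * f b) -> forall x y : T K I d,
  mapT e co f (mulT e co x y) = mulT e co (mapT e co f x) (mapT e co f y).
Proof.
move=> flin fM x y; move: x; apply: (linear_T_eq hbasis).
- exact: linear_comp (mapT_linear e co f (n := d)) (mulT_linearl e co y).
- exact: linear_comp (mulT_linearl e co _) (mapT_linear e co f (n := d)).
move=> b; move: y; apply: (linear_T_eq hbasis).
- exact: linear_comp (mapT_linear e co f (n := d)) (mulT_linearr e co _).
- exact: linear_comp (mulT_linearr e co _) (mapT_linear e co f (n := d)).
move=> c; rewrite (mulT_tenf hbasis) !(mapT_tenf hbasis) // (mulT_tenf hbasis).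
by apply: (eq_tenf hbasis) => k; rewrite fM.
Qed.

Section Placement.
Variables (K : comNzRingType) (B : algType K) (I : choiceType).
Variables (e : I -> B) (co : B -> {malg K[I]}).
Hypothesis hbasis : is_basisB e co.
Variables (d i : nat).
Hypothesis hi : (1 <= i < d)%N.
Local Notation place := (placeT e co d i).
Local Notation mul := (mulT e co).
Implicit Types (Z Y : T K I 2) (phi : T K I 2 -> T K I 2) (f : B -> B).

Lemma placeT_linear : linear place.
Proof. by move=> a Z Y; rewrite !placeT_emb emb_linear. Qed.

Lemma liftT_placeT phi Z : linear phi -> liftT i phi (place Z) = place (phi Z).
Proof. by move=> lphi; rewrite !placeT_emb (liftT_emb hbasis hi). Qed.

Lemma placeT_1 : place (oneT co 2) = oneT co d.
Proof. by rewrite placeT_emb (emb_1 hbasis hi). Qed.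

Lemma mapT_placeT f Z : linear f -> f 1 = 1 -> mapT e co f (place Z) = place (mapT e co f Z).
Proof.
move=> lf f1; rewrite !placeT_emb (mapT_emb hbasis hi) //.
exact: (eq_emb hbasis).
Qed.

Lemma mulT_placeT Z Y : mul (place Z) (place Y) = place (mul Z Y).
Proof.
rewrite !placeT_emb (mulT_emb hbasis hi); apply: (eq_emb hbasis) => k _ _.
by rewrite mulr1.
Qed.

Lemma liftT_mapT phi f x : linear phi -> linear f ->
  (forall Z, phi (mapT e co f Z) = mapT e co f (phi Z)) ->
  liftT i phi (mapT e co f x) = mapT e co f (liftT i phi x) :> T K I d.
Proof.
move=> lphi lf c; move: x; apply: (linear_T_eq hbasis).
- exact: linear_comp (@liftT_linear K I d i phi) (mapT_linear e co f (n := d)).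
- exact: linear_comp (mapT_linear e co f (n := d)) (@liftT_linear K I d i phi).
move=> b; rewrite (tenf_emb hbasis hi); set Z := tenf co _.
rewrite [mapT e co f (emb _ _ _ _ _)](mapT_emb hbasis hi b Z lf).
rewrite [LHS](liftT_emb hbasis hi _ _ lphi) [liftT _ _ _](liftT_emb hbasis hi b Z lphi).
by rewrite c [RHS](mapT_emb hbasis hi b (phi Z) lf).
Qed.

Lemma liftT_commutator (sg rh : T K I 2 -> T K I 2) f S x :
  linear sg -> linear rh -> linear f ->
  (forall Z, mul S (mapT e co f Z) - mul (sg (mapT e co f Z)) S =
     rh (mapT e co f Z) + mapT e co f (rh Z)) ->
  mul (place S) (mapT e co f x) - mul (liftT i sg (mapT e co f x)) (place S) =
  liftT i rh (mapT e co f x) + mapT e co f (liftT i rh x) :> T K I d.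
Proof.
move=> lsg lrh lf c.
have lm := mapT_linear e co f (n := d).
have l1 : linear (fun x : T K I d => mul (place S) (mapT e co f x)).
  exact: linear_comp (mulT_linearr e co _) lm.
have l2 : linear (fun x : T K I d => mul (liftT i sg (mapT e co f x)) (place S)).
  apply: linear_comp (mulT_linearl e co _) _.
  exact: linear_comp (@liftT_linear K I d i sg) lm.
have l3 : linear (fun x : T K I d => liftT i rh (mapT e co f x)).
  exact: linear_comp (@liftT_linear K I d i rh) lm.
have l4 : linear (fun x : T K I d => mapT e co f (liftT i rh x)).
  exact: linear_comp lm (@liftT_linear K I d i rh).
move: x; apply: (linear_T_eq hbasis).
- exact: linear_sub l1 l2.
- exact: linear_add l3 l4.
(* A pure tensor is its two-slot part embedded in the remaining factors. There the placed [S] is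
   [1], so left and right multiplication agree and the hypothesis on two factors applies. *)
move=> b; rewrite (tenf_emb hbasis hi) placeT_emb.
rewrite !((mapT_emb hbasis hi), (liftT_emb hbasis hi), (mulT_emb hbasis hi)) //.
set W := tenf co _; set c1 := fun k => f (b k).
rewrite (@eq_emb _ _ _ _ _ hbasis _ _ (fun k => 1 * c1 k) c1); last first.
  by move=> k _ _; rewrite mul1r.
rewrite (@eq_emb _ _ _ _ _ hbasis _ _ (fun k => c1 k * 1) c1); last first.
  by move=> k _ _; rewrite mulr1.
have lE := emb_linear e co i c1 (d := d).
have EB := @additive_of_linear _ _ _ _ lE.
by rewrite -EB c (additive_D EB).
Qed.

Variable j : nat.
Hypothesis hj : (1 <= j < d)%N.
Hypothesis hij : (i.+2 <= j \/ j.+2 <= i)%N.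

Let c1 x y : 'I_d -> B := ins j x y (fun => 1).

(** Seen from the slots of [i], a tensor supported on the disjoint slots of [j] is [1 (x) 1]. *)
Lemma placeT_far x y :
  placeT e co d j (tenf co (pair2 x y)) = emb e co i (c1 x y) (oneT co 2).
Proof.
rewrite placeT_emb (emb_tenf hbasis hj) -/(c1 x y) (tenf_emb hbasis hi) oneT_tenf.
congr emb; apply: (eq_tenf hbasis) => k; rewrite /pair2 /c1 /ins /=.
have -> : (i.-1 == j.-1) = false by lia.
have -> : (i.-1 == j) = false by lia.
have -> : (i == j.-1) = false by lia.
have -> : (i == j) = false by lia.
by case: ifP.
Qed.

Lemma liftT_placeT_far phi Z : linear phi ->
  liftT i phi (placeT e co d j Z) = mul (placeT e co d j Z) (place (phi (oneT co 2))).
Proof.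
have lj : linear (placeT e co d j) by move=> a Z' Y'; rewrite !placeT_emb emb_linear.
move=> lphi; move: Z; apply: (linear_T2_eq hbasis).
- exact: linear_comp (@liftT_linear K I d i phi) lj.
- exact: linear_comp (mulT_linearl e co _) lj.
move=> x y; rewrite placeT_far (liftT_emb hbasis hi) // placeT_emb (mulT_emb hbasis hi).
by rewrite (mulT_1l hbasis); apply: (eq_emb hbasis) => k _ _; rewrite mulr1.
Qed.

Lemma mulT_placeT_far Z Y :
  mul (place Z) (placeT e co d j Y) = mul (placeT e co d j Y) (place Z).
Proof.
have lj : linear (placeT e co d j) by move=> a Z' Y'; rewrite !placeT_emb emb_linear.
move: Y; apply: (linear_T2_eq hbasis).
- exact: linear_comp (mulT_linearr e co _) lj.
- exact: linear_comp (mulT_linearl e co _) lj.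
move=> x y; rewrite placeT_far placeT_emb !(mulT_emb hbasis hi).
rewrite (mulT_1l hbasis) (mulT_1r hbasis).
by apply: (eq_emb hbasis) => k _ _; rewrite mulr1 mul1r.
Qed.
End Placement.

(** * Small subalgebras of the quantum wreath product, and maps out of it *)

Section Wreath.
Variables (K : comNzRingType) (B : algType K) (I : choiceType).
Variables (e : I -> B) (co : B -> {malg K[I]}).
Hypothesis hbasis : is_basisB e co.
Variable d : nat.
Hypothesis hd : (2 <= d)%N.
Variables (S R : T K I 2) (sigma rho : {linear T K I 2 -> T K I 2}).
Variables (W : algType K) (iota : T K I d -> W) (H : nat -> W).
Hypothesis hW : is_qwreath e co S R sigma rho iota H.

Local Notation V := (tensor_ring hbasis d).
Local Notation s i := (placeT e co d i S).
Local Notation r i := (placeT e co d i R).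
Local Notation sg i := (liftT i sigma).
Local Notation rh i := (liftT i rho).

Let iota_lin : linear iota. Proof. exact: hW.1.1. Qed.

Lemma iotaB (x y : V) : iota (x - y) = iota x - iota y.
Proof. exact: (additive_of_linear iota_lin). Qed.

Lemma iotaM (x y : V) : iota (x * y) = iota x * iota y.
Proof. exact: hW.1.2.1. Qed.

Lemma iota1 : iota (1 : V) = 1.
Proof. exact: hW.1.2.2. Qed.

Lemma liftB i (phi : {linear T K I 2 -> T K I 2}) (x y : V) :
  liftT i phi (x - y) = liftT i phi x - liftT i phi y :> V.
Proof. exact: (additive_of_linear (@liftT_linear K I d i phi)). Qed.

Lemma wreath_free (rw : 'S_d -> seq nat) :
  is_basis (fun up : (d.-tuple I * 'S_d)%type =>
    iota (bT K up.1) * \prod_(i <- rw up.2) H i) ->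
  forall qs : seq ('S_d * T K I d), uniq [seq q.1 | q <- qs] ->
  \sum_(q <- qs) iota q.2 * \prod_(i <- rw q.1) H i = 0 ->
  all (fun q => q.2 == 0) qs.
Proof.
move=> hb qs uq qs0; apply/allP => q qin; apply/eqP.
exact: (basis_coef0_seq (h := fun p => \prod_(i <- rw p) H i) iota_lin hb uq qs0 qin).
Qed.

Lemma wreath_gen i : (1 <= i < d)%N ->
  @quad_gen V W iota (H i) (s i) (r i) (sg i) (rh i).
Proof.
move=> hi; have [_ [[_ [_ [hq hp]]] [_ [rw [hrw hb]]]]] := hW.
split; [exact: liftB|exact: liftB|exact: hq|by move=> x; apply: hp|move=> x y xy].
have := wreath_free hb (qs := [:: (1%g, x); (wperm d [:: i], y)]).
rewrite /= !big_cons big_nil /= (reduced_0 (hrw 1%g)) (reduced_1 hi (hrw _)).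
rewrite big_nil big_seq1 mulr1 addr0.
case/(_ _ xy)/and3P => [|/eqP -> /eqP ->] //.
rewrite andbT inE -[1%g](_ : wperm d [::] = _); last by rewrite /wperm big_nil.
apply: (@wperm_neq _ _ _ i) => //=; rewrite ?andbT //; first by case/andP: hi.
by case: swapP => *; apply/eqP; lia.
Qed.

Lemma wreath_pair_succ i : (1 <= i)%N -> (i.+1 < d)%N ->
  @quad_pair V W iota (H i) (s i) (r i) (sg i) (rh i)
    (H i.+1) (s i.+1) (r i.+1) (sg i.+1) (rh i.+1).
Proof.
move=> hi hi1; have h1 : (1 <= i < d)%N by lia.
have h2 : (1 <= i.+1 < d)%N by lia.
have [_ [[hbr _] [_ [rw [hrw hb]]]]] := hW.
split; [exact: wreath_gen|exact: wreath_gen|exact: hbr|].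
move=> x0 x1 x2 x12 x21 x121 x0E.
pose ws := [:: [::]; [:: i]; [:: i.+1]; [:: i; i.+1]; [:: i.+1; i]; [:: i; i.+1; i]].
have := wreath_free hb (qs := zip (map (wperm d) ws) [:: x0; x1; x2; x12; x21; x121]).
rewrite /= !big_cons big_nil /=.
have -> : rw (wperm d [::]) = [::].
  by have -> : wperm d [::] = 1%g; [rewrite /wperm big_nil|apply: reduced_0].
rewrite (reduced_1 h1 (hrw _)) (reduced_1 h2 (hrw _)).
rewrite (reduced_2 h1 h2 (or_intror erefl) (hrw _)).
rewrite (reduced_2 h2 h1 (or_introl erefl) (hrw _)).
(* Either reduced word of the longest element may have been chosen; the braid relation gives both
   the same product. *)
have -> : \prod_(k <- rw (wperm d [:: i; i.+1; i])) H k = H i * H i.+1 * H i.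
  case: (reduced_3 hi hi1 (hrw _)) => ->; rewrite !big_cons big_nil mulr1 mulrA //.
  by rewrite hbr.
rewrite !big_cons !big_nil !mulr1 addr0 !addrA => F.
have uw : uniq (map (wperm d) ws) by exact: wperm_short_uniq.
have /and5P[/eqP-> /eqP-> /eqP-> /eqP-> /and3P[/eqP-> /eqP-> _]] := F uw x0E.
by [].
Qed.

Lemma wreath_pair i j : (1 <= i < d)%N -> (1 <= j < d)%N -> i == j.+1 \/ j == i.+1 ->
  @quad_pair V W iota (H i) (s i) (r i) (sg i) (rh i) (H j) (s j) (r j) (sg j) (rh j).
Proof.
move=> hi hj [/eqP ij|/eqP ij]; rewrite ij.
  by apply: quad_pair_sym; apply: wreath_pair_succ; lia.
by apply: wreath_pair_succ; lia.
Qed.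

(** Independence applied to [H 1 = H] gives this in [B^{(x) d}], and injectivity of the placement
    descends it. It makes distant generators commute with placed tensors. *)
Lemma sigma_rho_1 : sigma (oneT co 2) = oneT co 2 /\ rho (oneT co 2) = 0.
Proof.
have hi : (1 <= 1 < d)%N by [].
have [s1 r1] := sg_rh_1 iotaB iota1 (wreath_gen hi).
have lsg : linear sigma by exact: linearP.
have lrh : linear rho by exact: linearP.
split; apply: (placeT_inj hbasis hi); rewrite -(liftT_placeT hbasis hi) // (placeT_1 hbasis hi).
  exact: s1.
rewrite [LHS]r1.
by have := additive_0 (additive_of_linear (placeT_linear e co d 1)) => ->.
Qed.

Lemma wreath_far i j Z : (1 <= i < d)%N -> (1 <= j < d)%N -> (i.+2 <= j \/ j.+2 <= i)%N ->
  H i * iota (placeT e co d j Z) = iota (placeT e co d j Z) * H i.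
Proof.
move=> hi hj hij; rewrite (push (wreath_gen hi)).
rewrite !(liftT_placeT_far hbasis hi hj hij); try exact: linearP.
have [-> ->] := sigma_rho_1; rewrite (placeT_1 hbasis hi) (mulT_1r hbasis).
have p0 := additive_0 (additive_of_linear (placeT_linear e co d i)).
have m0 := additive_0 (additive_of_linear (mulT_linearr e co (placeT e co d j Z))).
by rewrite p0 m0 (additive_0 (additive_of_linear iota_lin)) addr0.
Qed.

(** With [f] and [t] free, this builds both [#] and its inverse; the relations between distant
    generators are discharged here for both. *)
Lemma wreath_shift (f : B -> B) (t : T K I 2) :
  algHom f ->
  (forall i, (1 <= i < d)%N ->
     (- H i + iota (placeT e co d i t)) * (- H i + iota (placeT e co d i t)) =
     iota (mapT e co f (s i)) * (- H i + iota (placeT e co d i t)) +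
     iota (mapT e co f (r i)) /\
     forall x : T K I d, (- H i + iota (placeT e co d i t)) * iota (mapT e co f x) =
       iota (mapT e co f (sg i x)) * (- H i + iota (placeT e co d i t)) +
       iota (mapT e co f (rh i x))) ->
  (forall i, (1 <= i)%N -> (i.+1 < d)%N ->
     (- H i + iota (placeT e co d i t)) * (- H i.+1 + iota (placeT e co d i.+1 t))
       * (- H i + iota (placeT e co d i t)) =
     (- H i.+1 + iota (placeT e co d i.+1 t)) * (- H i + iota (placeT e co d i t))
       * (- H i.+1 + iota (placeT e co d i.+1 t))) ->
  exists g : W -> W, algHom g /\ (forall x, g (iota x) = iota (mapT e co f x)) /\
    (forall i, (1 <= i < d)%N -> g (H i) = - H i + iota (placeT e co d i t)).
Proof.
move=> [flin [fM f1]] hq hb; have [[_ [hM _]] [[_ [hfar _]] [univ _]]] := hW.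
have [] := univ W (fun x => iota (mapT e co f x))
  (fun i => - H i + iota (placeT e co d i t)); last by [].
- split; first exact: linear_comp iota_lin (mapT_linear e co f (n := d)).
  split=> [x y|].
    exact: etrans (congr1 iota (mapT_mulT hbasis flin fM x y)) (hM _ _).
  rewrite oneT_tenf (mapT_tenf hbasis) //.
  rewrite (@eq_tenf _ _ _ _ _ hbasis d _ (fun => 1)) -?oneT_tenf //.
  exact: iota1.
- split; first exact: hb.
  split=> [i j hi hj hij|].
    have hji : (j.+2 <= i \/ i.+2 <= j)%N by case: hij; [right|left].
    apply: comm_shift; first exact: hfar.
    - exact: (wreath_far _ hi hj hij).
    - exact: (wreath_far _ hj hi hji).
    have tij := mulT_placeT_far hbasis hi hj hij t t.
    exact: etrans (esym (hM _ _)) (etrans (congr1 iota tij) (hM _ _)).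
  by split=> i; [move=> hi; exact: (hq i hi).1|move=> x hi; exact: (hq i hi).2].
Qed.
End Wreath.

(** * The homomorphism *)

Section SharpLift.
Variables (K : comNzRingType) (B : algType K) (I : choiceType).
Variables (e : I -> B) (co : B -> {malg K[I]}).
Hypothesis hbasis : is_basisB e co.
Variables (d i : nat).
Hypothesis hi : (1 <= i < d)%N.
Variables (S R : T K I 2) (sigma rho : {linear T K I 2 -> T K I 2}) (f : B -> B).
Hypothesis hf : algHom f.
Local Notation V := (tensor_ring hbasis d).
Local Notation place := (placeT e co d i).
Local Notation Sh := (mapT e co f).

Let flin : linear f := hf.1.
Let f1 : f 1 = 1 := hf.2.2.
Let lsg : linear sigma. Proof. exact: linearP. Qed.
Let lrh : linear rho. Proof. exact: linearP. Qed.

Lemma sharp_compat_lift :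
  @sharp_compat V (mapT e co f (n := d)) (place S) (place R) (liftT i sigma) (liftT i rho) <->
  (sigma R = Sh R /\ sigma S = Sh S) /\
  forall b, sigma (Sh b) = Sh (sigma b) /\
    mulT e co S (Sh b) - mulT e co (sigma (Sh b)) S = rho (Sh b) + Sh (rho b).
Proof.
have liftP phi Z lphi := @liftT_placeT K B I e co hbasis d i hi phi Z lphi.
have mapP Z := @mapT_placeT K B I e co hbasis d i hi f Z flin f1.
split=> [|[[rE sE] c]]; last split.
- refine (@sharp_compat_pullback (tensor_ring hbasis d) _ (@mulT K B I e co 2) place
    _ _ _ (mapT e co f (n := 2)) sigma rho S R _ _ _ _ _ _).
  + exact: (placeT_inj hbasis hi).
  + exact: additive_of_linear (placeT_linear e co d i).
  + exact: (mulT_placeT hbasis hi).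
  + exact: mapP.
  + by move=> Z; exact: liftP.
  + by move=> Z; exact: liftP.
- exact: etrans (liftP _ R lsg) (etrans (congr1 place rE) (esym (mapP R))).
- exact: etrans (liftP _ S lsg) (etrans (congr1 place sE) (esym (mapP S))).
- move=> x; split.
    exact: (liftT_mapT hbasis hi x lsg flin (fun Z => (c Z).1)).
  exact: (liftT_commutator hbasis hi x lsg lrh flin (fun Z => (c Z).2)).
Qed.
End SharpLift.

Lemma algHom_additive (K : comNzRingType) (A A' : algType K) (g : A -> A') :
  algHom g -> forall x y, g (x - y) = g x - g y.
Proof. by case=> glin _; exact: additive_of_linear. Qed.

Theorem theorem7p2 (K : comNzRingType) (B : algType K) (I : choiceType)
    (e : I -> B) (co : B -> {malg K[I]}) (hbasis : is_basisB e co)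
    (d : nat) (hd : (2 <= d)%N)
    (S R : T K I 2) (sigma rho : {linear T K I 2 -> T K I 2})
    (W : algType K) (iota : T K I d -> W) (H : nat -> W)
    (hW : is_qwreath e co S R sigma rho iota H)
    (sh : B -> B) (hsh : algAut sh) :
  let Sh2 := mapT e co sh (n:=2) in
  let Shd := mapT e co sh (n:=d) in
  let ind (g : W -> W) :=
    algHom g /\ (forall x : T K I d, g (iota x) = iota (Shd x)) /\
    (forall i, (1 <= i < d)%N -> g (H i) = - H i + iota (placeT e co d i S)) in
  let conds :=
    (sigma R = Sh2 R /\ sigma S = Sh2 S) /\
    (forall b : T K I 2,
        sigma (Sh2 b) = Sh2 (sigma b) /\
        mulT e co S (Sh2 b) - mulT e co (sigma (Sh2 b)) S = rho (Sh2 b) + Sh2 (rho b)) /\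
    ((3 <= d)%N -> forall i j, (1 <= i < d)%N -> (1 <= j < d)%N ->
        (i == j.+1 \/ j == i.+1) ->
        let Si := placeT e co d i S in let Sj := placeT e co d j S in
        mulT e co (mulT e co Si Sj) Si
          + mulT e co (liftT i sigma Sj) (placeT e co d i R) =
        mulT e co (mulT e co Sj Si) Sj
          + mulT e co (liftT j sigma Si) (placeT e co d j R)) in
  ((exists g : W -> W, ind g) <-> conds) /\
  (conds -> forall g : W -> W, ind g -> bijective g).
Proof.
have [shom [ta shK taK]] := hsh.
have thom : algHom ta.
  have [slin [sM s1]] := shom.
  split; first by move=> a x y; apply: (can_inj shK); rewrite slin !taK.
  split; first by move=> x y; apply: (can_inj shK); rewrite sM !taK.
  by apply: (can_inj shK); rewrite s1 taK.
have ShK n : cancel (mapT e co sh (n := n)) (mapT e co ta (n := n)).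
  move=> x; move: x; apply: (linear_T_eq hbasis) => // [|b].
    exact: linear_comp (mapT_linear e co ta (n := n)) (mapT_linear e co sh (n := n)).
  rewrite (mapT_tenf hbasis _ shom.1) (mapT_tenf hbasis _ thom.1).
  by apply: (eq_tenf hbasis) => k; rewrite shK.
have taSK n : cancel (mapT e co ta (n := n)) (mapT e co sh (n := n)).
  move=> x; move: x; apply: (linear_T_eq hbasis) => // [|b].
    exact: linear_comp (mapT_linear e co sh (n := n)) (mapT_linear e co ta (n := n)).
  rewrite (mapT_tenf hbasis _ thom.1) (mapT_tenf hbasis _ shom.1).
  by apply: (eq_tenf hbasis) => k; rewrite taK.
have shB := additive_of_linear (mapT_linear e co sh (n := d)).
have shM := mapT_mulT hbasis (d := d) shom.1 shom.2.1.
have iB := iotaB (hbasis := hbasis) hW; have iM := iotaM (hbasis := hbasis) hW.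
have i1 := iota1 hbasis hW.
have [_ [_ [univ _]]] := hW.
move=> Sh2 Shd ind conds.
pose compat i := @sharp_compat (tensor_ring hbasis d) Shd (placeT e co d i S)
  (placeT e co d i R) (liftT i sigma) (liftT i rho).
have compatP i (hi : (1 <= i < d)%N) := sharp_compat_lift hbasis hi S R sigma rho shom.
have conds_compat : conds -> forall i, (1 <= i < d)%N -> compat i.
  by case=> c1 [c2 _] i hi; apply/(compatP i hi).
have conds3 : conds -> forall i, (1 <= i)%N -> (i.+1 < d)%N ->
    mulT e co (mulT e co (placeT e co d i S) (placeT e co d i.+1 S)) (placeT e co d i S)
      + mulT e co (liftT i sigma (placeT e co d i.+1 S)) (placeT e co d i R) =
    mulT e co (mulT e co (placeT e co d i.+1 S) (placeT e co d i S)) (placeT e co d i.+1 S)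
      + mulT e co (liftT i.+1 sigma (placeT e co d i S)) (placeT e co d i.+1 R).
  case=> _ [_ c3] i hi hi1; apply: c3; [lia|lia|lia|by right].
have conds_ind : conds -> exists g, ind g.
  move=> c; apply: (wreath_shift hbasis hd hW shom) => [i hi|i hi hi1].
    exact: (sharp_compatP iB iM _ (wreath_gen hbasis hd hW hi)).1 (conds_compat c i hi).
  exact: (shift_braid iB iM i1 (wreath_pair_succ hbasis hd hW hi hi1)).2 (conds3 c i hi hi1).
have ind_conds g : ind g -> conds.
  move=> [ghom [gi gH]]; have [glin [gM _]] := ghom.
  have c i : (1 <= i < d)%N -> compat i.
    move=> hi; exact: (hom_sharp_compat iB iM (wreath_gen hbasis hd hW hi)
      (algHom_additive ghom) gM gi (gH i hi)).
  (* The bound [2 <= d] is exactly the existence of the generator [H 1], and one generator already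
     yields (1) and (2). *)
  have c12 := (compatP 1%N hd).1 (c 1%N hd).
  split; [exact: c12.1|split; [exact: c12.2|]].
  move=> d3 i j hi hj ij.
  exact: (hom_shift_braid iB iM i1 (wreath_pair hbasis hd hW hi hj ij) gM (gH i hi) (gH j hj)).
split; first by split=> [[g]|]; [exact: ind_conds|exact: conds_ind].
move=> c g [ghom [gi gH]].
(* The shift of the inverse appears as a placed tensor in [wreath_shift] and as the preimage of
   [S_i] in the ring lemmas; this identifies the two. *)
have tS i : (1 <= i < d)%N ->
    placeT e co d i (mapT e co ta S) = mapT e co ta (placeT e co d i S).
  by move=> hi; exact: esym (mapT_placeT hbasis hi S thom.1 thom.2.2).
have [g' [g'hom [g'i g'H]]] : exists g' : W -> W, algHom g' /\
    (forall x, g' (iota x) = iota (mapT e co ta x)) /\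
    (forall i, (1 <= i < d)%N -> g' (H i) = - H i + iota (placeT e co d i (mapT e co ta S))).
  apply: (wreath_shift hbasis hd hW thom) => [i hi|i hi hi1].
    have hg := wreath_gen hbasis hd hW hi; rewrite (tS i hi); split.
      exact: (unsharp_square iB iM shB shM (ShK d) (taSK d) hg (conds_compat c i hi)).
    exact: (unsharp_push iB iM shB shM (ShK d) (taSK d) hg (conds_compat c i hi)).
  have h1 : (1 <= i < d)%N by lia.
  have h2 : (1 <= i.+1 < d)%N by lia.
  rewrite (tS i h1) (tS i.+1 h2).
  exact: (unsharp_braid iB iM i1 shB shM (ShK d) (taSK d)
    (wreath_pair_succ hbasis hd hW hi hi1) (conds_compat c i h1) (conds_compat c _ h2)
    (conds3 c i hi hi1)).
(* Uniqueness in the universal property, with [W] itself as target, recognises both composites as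
   the identity. *)
have idW (k : W -> W) : algHom k -> (forall x, k (iota x) = iota x) ->
    (forall i, (1 <= i < d)%N -> k (H i) = H i) -> forall w, k w = w.
  move=> khom ki kH; have [_ uniq_hom] := univ W iota H hW.1 hW.2.1.
  by apply: (uniq_hom k id) => //; split.
have comp_hom (k l : W -> W) : algHom k -> algHom l -> algHom (k \o l).
  case=> [klin [kM k1]] [llin [lM l1]]; split; first by move=> a x y; rewrite /= llin klin.
  by split=> [x y|] /=; rewrite ?lM ?kM ?l1.
exists g'; apply: (idW (_ \o _)).
- exact: comp_hom.
- by move=> x; apply: etrans (congr1 g' (gi x)) (etrans (g'i _) (congr1 iota (ShK d x))).
- move=> i hi; rewrite /= (gH i hi).
  apply: (additive_unshift (algHom_additive g'hom) (g'H i hi)); rewrite (tS i hi); exact: g'i.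
- exact: comp_hom.
- by move=> x; apply: etrans (congr1 g (g'i x)) (etrans (gi _) (congr1 iota (taSK d x))).
- move=> i hi; rewrite /= (g'H i hi).
  apply: (additive_unshift (algHom_additive ghom) (gH i hi)); rewrite (tS i hi).
  exact: etrans (gi _) (congr1 iota (taSK d _)).
Qed.
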